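(* Let $G$ be a graph of order $n\ge 3$ and maximum degree $\Delta(G)=2$. Then $\mathcal{A}(G)\le \mathcal{A}(U_n)$, with equality if and only if $G$ is isomorphic to $U_n$, where $U_n=\frac{n}{3}K_3$ if $n\equiv 0 \pmod 3$; $U_n=\frac{n-1}{3}K_3\cup K_1$ if $n=4$ or $n=7$; $U_n=\frac{n-4}{3}K_3\cup C_4$ if $n\equiv 1\pmod 3$ and $n\ge 10$; $U_n=\frac{n-5}{3}K_3\cup C_5$ if $n\equiv 2\pmod 3$ and $n\ge 5$.
   Context: Graphs are finite and simple. For a graph $G$ of order $n$ and an integer $k$, $S(G,k)$ denotes the number of partitions of $V(G)$ into exactly $k$ nonempty stable sets (non-equivalent colorings with exactly $k$ colors). Let $\mathcal{B}(G)=\sum_{k=1}^n S(G,k)$, $\mathcal{T}(G)=\sum_{k=1}^n kS(G,k)$, and $\mathcal{A}(G)=\mathcal{T}(G)/\mathcal{B}(G)$. $G\cup H$ denotes disjoint union, $pH$ the disjoint union of $p$ copies of $H$ ($0H$ is the graph with no vertices), $K_m$ the complete graph and $C_m$ the cycle on $m$ vertices. *)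

(* Defs.v *)
From mathcomp Require Import all_boot all_order all_algebra.

Set Implicit Arguments.
Unset Strict Implicit.
Unset Printing Implicit Defensive.

Record sgraph := SGraph {
  vertex :> finType;
  adj : rel vertex;
  adj_sym : symmetric adj;
  adj_irr : irreflexive adj }.

Definition isomorphic (G H : sgraph) : Prop :=
  exists2 f : G -> H, bijective f & forall x y, adj (f x) (f y) = adj x y.

Definition degree (G : sgraph) (x : G) : nat := #|[set y | adj x y]|.

Definition max_degree (G : sgraph) : nat := \max_(x : G) degree x.

Definition stable (G : sgraph) (A : {set G}) : bool :=
  [forall x in A, forall y in A, ~~ adj x y].

(* [partition] already requires the blocks to be nonempty. *)
Definition stable_partitions (G : sgraph) (k : nat) : {set {set {set G}}} :=
  [set P : {set {set G}} |
    [&& partition P [set: G], #|P| == k & [forall A in P, stable A]]].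

Definition S_ (G : sgraph) (k : nat) : nat := #|stable_partitions G k|.

Definition B_ (G : sgraph) : nat := \sum_(1 <= k < #|G|.+1) S_ G k.

Definition T_ (G : sgraph) : nat := \sum_(1 <= k < #|G|.+1) k * S_ G k.

Definition A_ (G : sgraph) : rat := ((T_ G)%:R / (B_ G)%:R)%R.

Section Union.
Variables G H : sgraph.

Definition union_adj : rel (G + H)%type := fun u v =>
  match u, v with
  | inl x, inl y => adj x y
  | inr x, inr y => adj x y
  | _, _ => false
  end.

Lemma union_adj_sym : symmetric union_adj.
Proof. by case=> x [] y //=; apply: adj_sym. Qed.

Lemma union_adj_irr : irreflexive union_adj.
Proof. by case=> x /=; apply: adj_irr. Qed.

Definition disjoint_union : sgraph := SGraph union_adj_sym union_adj_irr.
End Union.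

Section Copies.
Variables (p : nat) (H : sgraph).

Definition copies_adj : rel ('I_p * H)%type :=
  fun u v => (u.1 == v.1) && adj u.2 v.2.

Lemma copies_adj_sym : symmetric copies_adj.
Proof. by move=> u v; rewrite /copies_adj eq_sym adj_sym. Qed.

Lemma copies_adj_irr : irreflexive copies_adj.
Proof. by move=> u; rewrite /copies_adj adj_irr andbF. Qed.

Definition copies : sgraph := SGraph copies_adj_sym copies_adj_irr.
End Copies.

Section CompleteCycle.
Variable m : nat.

Definition complete_adj : rel 'I_m := fun i j => i != j.

Lemma complete_adj_sym : symmetric complete_adj.
Proof. by move=> i j; rewrite /complete_adj eq_sym. Qed.

Lemma complete_adj_irr : irreflexive complete_adj.
Proof. by move=> i; rewrite /complete_adj eqxx. Qed.

Definition K_ : sgraph := SGraph complete_adj_sym complete_adj_irr.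

(* The conjunct [i != j] only matters for m = 1; C_ m is a cycle for m >= 3. *)
Definition cycle_adj : rel 'I_m := fun i j =>
  (i != j) && ((j == i.+1 %% m :> nat) || (i == j.+1 %% m :> nat)).

Lemma cycle_adj_sym : symmetric cycle_adj.
Proof. by move=> i j; rewrite /cycle_adj eq_sym orbC. Qed.

Lemma cycle_adj_irr : irreflexive cycle_adj.
Proof. by move=> i; rewrite /cycle_adj eqxx. Qed.

Definition C_ : sgraph := SGraph cycle_adj_sym cycle_adj_irr.
End CompleteCycle.

(* Meant for n >= 3: then the third branch means n = 1 mod 3 with n >= 10, and
   the last one n = 2 mod 3 with n >= 5, so all subtractions and divisions are
   exact. *)
Definition U_ (n : nat) : sgraph :=
  if n %% 3 == 0 then copies (n %/ 3) (K_ 3)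
  else if (n == 4) || (n == 7) then
    disjoint_union (copies ((n - 1) %/ 3) (K_ 3)) (K_ 1)
  else if n %% 3 == 1 then
    disjoint_union (copies ((n - 4) %/ 3) (K_ 3)) (C_ 4)
  else disjoint_union (copies ((n - 5) %/ 3) (K_ 3)) (C_ 5).

(* Main.v *)
(* Write B(G) = L(P_G), where P_G is the chromatic polynomial and L the linear
   functional with L(x^_j) = 1, i.e. the expectation under a Poisson variable of
   mean 1 (Dobinski). Then A(G) + 1 = L(x P_G) / L(P_G), and for graphs F u H and
   F' u H the sign of A(F' u H) - A(F u H) is that of the expectation, over two
   independent Poisson variables X and Y, of
     P_H(X) P_H(Y) (X - Y) (P_F(Y) P_F'(X) - P_F(X) P_F'(Y)).
   So replacing F by F' strictly increases A, whatever H, as soon as P_F'/P_F is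
   nondecreasing on the natural numbers. A graph of maximum degree at most 2 is a
   disjoint union of paths and cycles, and replacements of this kind (splitting a
   triangle off a long path or cycle, merging two small components) lead to a
   union of triangles with at most one further component among K_1, K_2, C_4, C_5.
   Triangles with K_1 against triangles with C_4 is the one comparison where the
   ratio is not monotone: the double sum is then estimated directly, and the
   orders 4 and 7, where K_1 wins, are computed explicitly. *)
Require Import Defs.
From mathcomp Require Import all_boot all_order all_algebra.
From mathcomp Require Import ring lra zify.

Set Implicit Arguments.
Unset Strict Implicit.
Unset Printing Implicit Defensive.

Import Order.TTheory GRing.Theory Num.Theory.

Local Open Scope ring_scope.

(** * Truncated Poisson sums *)

Definition exp_sum (N : nat) : rat := \sum_(i < N) (i`!)%:R^-1.

Definition poisson_sum (F : nat -> rat) (N : nat) : rat :=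
  \sum_(x < N) F x / (x`!)%:R.

Definition ffact_poly (n : nat) (c : nat -> rat) (x : nat) : rat :=
  \sum_(j < n) c j * (x ^_ j)%:R.

Definition coef_mass (n : nat) (c : nat -> rat) : rat := \sum_(j < n) c j.

Definition coef_moment (n : nat) (c : nat -> rat) : rat :=
  \sum_(j < n) j%:R * c j.

(** This says [u N = O(1/N)]. The limits at stake are multiples of e, which is irrational; to stay
    in [rat], sums are compared with multiples of [exp_sum N], with this rate in place of
    convergence. *)
Definition vanishing (u : nat -> rat) : Prop :=
  exists C, forall N : nat, `|u N| * N%:R <= C.

Definition bounded_seq (u : nat -> rat) : Prop :=
  exists C, forall N : nat, `|u N| <= C.

Lemma exp_sumS N : exp_sum N.+1 = exp_sum N + (N`!)%:R^-1.
Proof. by rewrite /exp_sum big_ord_recr. Qed.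

Lemma poisson_sumS F N :
  poisson_sum F N.+1 = poisson_sum F N + F N / (N`!)%:R.
Proof. by rewrite /poisson_sum big_ord_recr. Qed.

Lemma natfact_gt0 N : 0 < (N`!)%:R :> rat.
Proof. by rewrite ltr0n fact_gt0. Qed.

Lemma natfact_neq0 N : (N`!)%:R != 0 :> rat.
Proof. by rewrite gt_eqF // natfact_gt0. Qed.

Lemma exp_sum_ge1 N : 1 <= exp_sum N.+1.
Proof.
elim: N => [|N IH]; first by rewrite exp_sumS /exp_sum big_ord0 fact0 invr1 add0r.
by rewrite exp_sumS (le_trans IH) // lerDl invr_ge0 ltW // natfact_gt0.
Qed.

Lemma exp_sum_ge0 N : 0 <= exp_sum N.
Proof. by apply: sumr_ge0 => i _; rewrite invr_ge0 ltW // natfact_gt0. Qed.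

Lemma exp_sum_le3 N : exp_sum N <= 3%:R.
Proof.
(* Strengthened for the induction: the slack [1/(M+1)!] pays for the next term, because
   [2/(M+2)! <= 1/(M+1)!]. *)
suff aux M : exp_sum M.+2 <= 3%:R - (M.+1`!)%:R^-1.
  apply: (@le_trans _ _ (exp_sum N.+2)).
    rewrite !exp_sumS -addrA lerDl.
    by apply: addr_ge0; rewrite invr_ge0 ltW // natfact_gt0.
  by apply: (le_trans (aux N)); rewrite lerBlDr lerDl invr_ge0 ltW // natfact_gt0.
elim: M => [|M IH]; first by rewrite !exp_sumS /exp_sum big_ord0.
rewrite exp_sumS.
have H : 2%:R * (M.+2`!)%:R^-1 <= (M.+1`!)%:R^-1 :> rat.
  rewrite [(M.+2)`!]factS natrM invfM mulrA.
  rewrite -[leRHS]mul1r; apply: ler_wpM2r; first by rewrite invr_ge0 ltW // natfact_gt0.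
  by rewrite ler_pdivrMr ?ltr0n // mul1r ler_nat.
lra.
Qed.

Lemma vanishingD u v : vanishing u -> vanishing v ->
  vanishing (fun N => u N + v N).
Proof.
move=> [C hC] [D hD]; exists (C + D) => N.
apply: le_trans (lerD (hC N) (hD N)).
by rewrite -mulrDl ler_wpM2r ?ler0n // ler_normD.
Qed.

Lemma vanishingM u v : bounded_seq u -> vanishing v ->
  vanishing (fun N => u N * v N).
Proof.
move=> [C hC] [D hD]; exists (C * D) => N.
by rewrite normrM -mulrA; apply: ler_pM; rewrite ?mulr_ge0 ?ler0n.
Qed.

Lemma bounded_cst a : bounded_seq (fun=> a).
Proof. by exists `|a|. Qed.

Lemma bounded_exp_sum : bounded_seq exp_sum.
Proof. by exists 3%:R => N; rewrite ger0_norm ?exp_sum_ge0 ?exp_sum_le3. Qed.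

Lemma boundedM u v : bounded_seq u -> bounded_seq v ->
  bounded_seq (fun N => u N * v N).
Proof.
move=> [C hC] [D hD]; exists (C * D) => N.
by rewrite normrM; apply: ler_pM.
Qed.

Lemma vanishing_bounded u : vanishing u -> bounded_seq u.
Proof.
(* At index 0 the factor [N] makes the hypothesis void, hence the separate summand for [u 0]. *)
move=> [C hC]; exists (`|u 0%N| + `|C|) => -[|N]; first by rewrite lerDl.
have h : `|u N.+1| <= `|u N.+1| * N.+1%:R.
  by rewrite -[leLHS]mulr1 ler_wpM2l // ler1n.
apply: (le_trans h); apply: (le_trans (hC N.+1)); apply: (le_trans (ler_norm C)).
by rewrite lerDr.
Qed.

Lemma boundedD u v : bounded_seq u -> bounded_seq v ->
  bounded_seq (fun N => u N + v N).
Proof.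
move=> [C hC] [D hD]; exists (C + D) => N.
exact: le_trans (ler_normD _ _) (lerD (hC N) (hD N)).
Qed.

Lemma eq_vanishing u v : u =1 v -> vanishing u -> vanishing v.
Proof. by move=> e [C h]; exists C => N; rewrite -e. Qed.

Lemma vanishing_sum n (u : nat -> nat -> rat) :
  (forall j, vanishing (u j)) -> vanishing (fun N => \sum_(j < n) u j N).
Proof.
move=> h; elim: n => [|n IH].
  by exists 0 => N; rewrite big_ord0 normr0 mul0r.
apply: eq_vanishing (vanishingD IH (h n)) => N.
by rewrite big_ord_recr.
Qed.

Lemma vanishing_exp_sum_shift j :
  vanishing (fun N => exp_sum (N - j) - exp_sum N).
Proof.
elim: j => [|j IH].
  by exists 0 => N; rewrite subn0 subrr normr0 mul0r.
suff h : vanishing (fun N => exp_sum (N - j.+1) - exp_sum (N - j)).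
  by apply: eq_vanishing (vanishingD h IH) => N; rewrite addrA subrK.
(* The constant fits: with [N = M + j + 1], the bounds [M <= M!] and [1 <= M!] give
   [N <= (j + 2) * M!]. *)
exists j.+2%:R => N; rewrite subnS.
case E : (N - j)%N => [|M] /=; first by rewrite subrr normr0 mul0r.
rewrite exp_sumS opprD addrA subrr add0r normrN ger0_norm; last first.
  by rewrite invr_ge0 ltW // natfact_gt0.
have -> : N = (M + j.+1)%N by lia.
rewrite mulrC ler_pdivrMr ?natfact_gt0 // -natrM ler_nat.
have h1 : (M <= M`!)%N by apply: fact_geq.
have h2 : (0 < M`!)%N by apply: fact_gt0.
by nia.
Qed.

(** [x ^_ j / x!] is [1/(x-j)!] for [j <= x] and 0 below, so the sum is a shifted exponential sum.
    Up to the factor e, every falling factorial thus has expectation 1. *)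
Lemma poisson_sum_ffact j N :
  poisson_sum (fun x => (x ^_ j)%:R) N = exp_sum (N - j).
Proof.
elim: N => [|N IH]; first by rewrite /poisson_sum /exp_sum !big_ord0.
rewrite poisson_sumS IH; case: (ltnP N j) => h.
  rewrite ffact_small // mul0r addr0; congr exp_sum; lia.
rewrite subSn // exp_sumS; congr (_ + _).
rewrite -(ffact_fact h) natrM invfM mulrA divff ?mul1r //.
by rewrite pnatr_eq0 -lt0n ffact_gt0.
Qed.

Lemma natr_ffactSr x j : (x ^_ j.+1)%:R = (x ^_ j)%:R * (x%:R - j%:R) :> rat.
Proof.
case: (leqP j x) => h; first by rewrite ffactnSr natrM natrB.
by rewrite !ffact_small ?mul0r // ltnW.
Qed.

(** Rests on [x * x ^_ j = x ^_ j.+1 + j * x ^_ j]. *)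
Lemma poisson_sum_ffact_moment j N :
  poisson_sum (fun x => x%:R * (x ^_ j)%:R) N =
  exp_sum (N - j.+1) + j%:R * exp_sum (N - j).
Proof.
rewrite -!poisson_sum_ffact /poisson_sum mulr_sumr -big_split /=.
apply: eq_bigr => x _; rewrite natr_ffactSr mulrA -mulrDl; congr (_ / _).
ring.
Qed.

Lemma poisson_sum_lin n (c : nat -> rat) (f : nat -> nat -> rat) N :
  poisson_sum (fun x => \sum_(j < n) c j * f j x) N =
  \sum_(j < n) c j * poisson_sum (f j) N.
Proof.
rewrite /poisson_sum; under eq_bigr do rewrite mulr_suml.
rewrite exchange_big /=; apply: eq_bigr => j _; rewrite mulr_sumr.
by apply: eq_bigr => x _; rewrite mulrA.
Qed.

Lemma eq_poisson_sum F F' N : F =1 F' -> poisson_sum F N = poisson_sum F' N.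
Proof. by move=> e; apply: eq_bigr => x _; rewrite e. Qed.

Lemma poisson_sum_limit n c F : F =1 ffact_poly n c ->
  vanishing (fun N => poisson_sum F N - coef_mass n c * exp_sum N).
Proof.
move=> eF.
apply: eq_vanishing (vanishing_sum n (u := fun j N =>
  c j * (exp_sum (N - j) - exp_sum N)) _) => [N|j]; last first.
  exact: vanishingM (bounded_cst _) (vanishing_exp_sum_shift j).
rewrite (eq_poisson_sum _ eF)
  (poisson_sum_lin n c (fun j x => (x ^_ j)%:R)) mulr_suml -sumrB.
by apply: eq_bigr => j _; rewrite poisson_sum_ffact mulrBr.
Qed.

(** Multiplication by [x] turns the contribution 1 of [x ^_ j] into [1 + j], whence mass plus
    moment. *)
Lemma poisson_sum_moment_limit n c F : F =1 ffact_poly n c ->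
  vanishing (fun N => poisson_sum (fun x => x%:R * F x) N
    - (coef_mass n c + coef_moment n c) * exp_sum N).
Proof.
move=> eF.
apply: eq_vanishing (vanishing_sum n (u := fun j N =>
  c j * ((exp_sum (N - j.+1) - exp_sum N)
         + j%:R * (exp_sum (N - j) - exp_sum N))) _) => [N|j]; last first.
  apply: vanishingM (bounded_cst _) _.
  apply: vanishingD (vanishing_exp_sum_shift _) _.
  exact: vanishingM (bounded_cst _) (vanishing_exp_sum_shift j).
have eF' x : x%:R * F x = \sum_(j < n) c j * (x%:R * (x ^_ j)%:R).
  by rewrite eF mulr_sumr; apply: eq_bigr => j _; ring.
rewrite (eq_poisson_sum _ eF')
  (poisson_sum_lin n c (fun j x => x%:R * (x ^_ j)%:R)).
rewrite /coef_mass /coef_moment -big_split /= mulr_suml -sumrB.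
by apply: eq_bigr => j _; rewrite poisson_sum_ffact_moment; ring.
Qed.

(** * Symmetrised double sums and their limit *)

Definition cross_row (F F' : nat -> rat) (x : nat) : rat :=
  \sum_(y < x) (x%:R - y%:R) * (F x * F' y - F y * F' x)
               / ((x`!)%:R * (y`!)%:R).

Definition cross_sum (F F' : nat -> rat) (N : nat) : rat :=
  poisson_sum (fun x => x%:R * F x) N * poisson_sum F' N
  - poisson_sum F N * poisson_sum (fun x => x%:R * F' x) N.

(** The product expands into terms [(x - y) * F x * F' y / (x! * y!)]. The diagonal vanishes, and
    the terms of [(x, y)] and [(y, x)] are merged and filed under the larger index. *)
Lemma cross_sum_rows F F' N :
  cross_sum F F' N = \sum_(x < N) cross_row F F' x.
Proof.
elim: N => [|N IH]; first by rewrite /cross_sum /poisson_sum !big_ord0; ring.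
rewrite big_ord_recr /= -IH /cross_sum !poisson_sumS.
have -> : cross_row F F' N = (N`!)%:R^-1 *
   (N%:R * F N * poisson_sum F' N - N%:R * F' N * poisson_sum F N
    - F N * poisson_sum (fun x => x%:R * F' x) N
    + F' N * poisson_sum (fun x => x%:R * F x) N).
  rewrite /poisson_sum !mulr_sumr -sumrB -sumrB -big_split /= mulr_sumr.
  apply: eq_bigr => y _.
  by field; rewrite !natfact_neq0.
by field; rewrite natfact_neq0.
Qed.

Section CrossLimit.
Variables (n n' : nat) (c c' : nat -> rat) (F F' : nat -> rat).
Hypothesis eF : F =1 ffact_poly n c.
Hypothesis eF' : F' =1 ffact_poly n' c'.

(** For the coefficients of two chromatic polynomials this is [T * B' - B * T'], which has the sign
    of the difference of the two averages. *)
Let gap := coef_moment n c * coef_mass n' c' - coef_mass n c * coef_moment n' c'.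

(** The product of the two masses cancels, which leaves [gap]. In each product of sums the factors
    are replaced by their limits one at a time, the other factor being bounded. *)
Lemma cross_sum_limit :
  vanishing (fun N => cross_sum F F' N - gap * exp_sum N ^+ 2).
Proof.
have bd a : bounded_seq (fun N => a * exp_sum N).
  exact: boundedM (bounded_cst _) bounded_exp_sum.
have hF := poisson_sum_limit eF; have hF' := poisson_sum_limit eF'.
have hM := poisson_sum_moment_limit eF; have hM' := poisson_sum_moment_limit eF'.
have bF' : bounded_seq (poisson_sum F').
  have [C hC] := boundedD (vanishing_bounded hF') (bd (coef_mass n' c')).
  by exists C => N; have := hC N; rewrite subrK.
have bM' : bounded_seq (poisson_sum (fun x => x%:R * F' x)).
  have [C hC] := boundedD (vanishing_bounded hM')
    (bd (coef_mass n' c' + coef_moment n' c')).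
  by exists C => N; have := hC N; rewrite subrK.
have v1 := vanishingM bF' hM.
have v2 := vanishingM (bd (coef_mass n c + coef_moment n c)) hF'.
have v3 := vanishingM bM' hF.
have v4 := vanishingM (bd (coef_mass n c)) hM'.
have v34 := vanishingM (bounded_cst (-1)) (vanishingD v3 v4).
apply: eq_vanishing (vanishingD (vanishingD v1 v2) v34) => N.
by rewrite /cross_sum /gap; ring.
Qed.

(** A strict inequality may be lost in the limit, hence the margin [d], uniform in [N]. If [gap]
    were nonnegative, [cross_sum] would stay at distance at least [d] from [gap * exp_sum N ^+ 2],
    against the rate [O(1/N)]. *)
Lemma gap_lt0 (d : rat) (N0 : nat) : 0 < d ->
  (forall N, (N0 <= N)%N -> cross_sum F F' N <= - d) -> gap < 0.
Proof.
move=> d_gt0 hd; rewrite ltNge; apply/negP => gap_ge0.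
have [C hC] := cross_sum_limit.
have [M hM] : exists M : nat, C / d < M%:R.
  exists (Num.bound `|C / d|); apply: le_lt_trans (ler_norm _) _.
  exact: archi_boundP (normr_ge0 _).
pose N := maxn N0 M; have := hC N.
have h1 : cross_sum F F' N <= - d by apply: hd; apply: leq_maxl.
have h2 : 0 <= gap * exp_sum N ^+ 2 by apply: mulr_ge0 => //; apply: sqr_ge0.
have h3 : d <= `|cross_sum F F' N - gap * exp_sum N ^+ 2|.
  by rewrite ler0_norm; lra.
have h4 : C < d * N%:R.
  rewrite mulrC -ltr_pdivrMr //; apply: lt_le_trans hM _.
  by rewrite ler_nat leq_maxr.
move=> h5; have h6 : d * N%:R <= `|cross_sum F F' N - gap * exp_sum N ^+ 2| * N%:R.
  by apply: ler_wpM2r => //; apply: ler0n.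
lra.
Qed.

(** The quotient of moment by mass depends on the function only, not on its expansion, so [A_] may
    be read off any expansion of the coloring count. Here [cross_sum] is identically 0 while
    [exp_sum N ^+ 2] stays at least 1. *)
Lemma gap_eq0 : F =1 F' -> gap = 0.
Proof.
move=> e; apply/eqP/contraT => gap_neq0.
have [C hC] := cross_sum_limit.
have z N : cross_sum F F' N = 0.
  rewrite /cross_sum (eq_poisson_sum _ e).
  have e' x : x%:R * F x = x%:R * F' x by rewrite e.
  by rewrite (eq_poisson_sum _ e') mulrC subrr.
have gap_gt0 : 0 < `|gap| by rewrite normr_gt0.
have := archi_boundP (normr_ge0 (C / `|gap|)).
(* The index is [M.+1] because [exp_sum 0] is 0 and the lower bound 1 starts at index 1. *)
set M := Num.bound _ => hM; have := hC M.+1.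
rewrite z sub0r normrN normrM.
have h1 : 1 <= `|exp_sum M.+1 ^+ 2|.
  by rewrite ger0_norm ?sqr_ge0 // exprn_ege1 // exp_sum_ge1.
have h2 : `|gap| * M.+1%:R <= `|gap| * `|exp_sum M.+1 ^+ 2| * M.+1%:R.
  by rewrite ler_wpM2r ?ler0n // ler_peMr.
have h3 : C < `|gap| * M.+1%:R.
  rewrite mulrC -ltr_pdivrMr //; apply: le_lt_trans (ler_norm _) _.
  by apply: (lt_trans hM); rewrite ltr_nat.
by move=> h4; have := lt_le_trans h3 (le_trans h2 h4); rewrite ltxx.
Qed.

End CrossLimit.

(** * Counting proper_coloring colorings *)

(** A function with fibre partition [P] is an injection of the blocks into [C] composed with the
    block map; [phi] is this composition, and the representatives [rep] recover the injection. *)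
Lemma card_preim_partition (T C : finType) (P : {set {set T}}) :
  partition P [set: T] ->
  #|[set f : {ffun T -> C} | preim_partition f [set: T] == P]| = (#|C| ^_ #|P|)%N.
Proof.
case/and3P=> /eqP covP trP P0.
have inP x : pblock P x \in P by rewrite pblock_mem // covP.
pose D := {B : {set T} | B \in P}.
pose blk x : D := Sub (pblock P x) (inP x).
pose phi (g : {ffun D -> C}) : {ffun T -> C} := [ffun x => g (blk x)].
have neP (B : D) : exists x, x \in val B.
  by apply/set0Pn; apply: contraNneq P0 => <-; apply: valP.
pose rep (B : D) : T := xchoose (neP B).
have repP B : blk (rep B) = B.
  by apply: val_inj; apply: (def_pblock trP (valP B)); apply: (xchooseP (neP B)).
have -> : [set f : {ffun T -> C} | preim_partition f [set: T] == P] =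
          phi @: [set g : {ffun D -> C} | injectiveb g].
  apply/setP=> f; rewrite inE; apply/eqP/imsetP => [eP | [g]].
    have sameE x y : (y \in pblock P x) = (f x == f y).
      rewrite -eP pblock_equivalence_partition ?inE // => u v w _ _ _ /=.
      by split=> // /eqP->.
    have blkE x y : (blk x == blk y) = (f x == f y).
      by rewrite -val_eqE /= eq_pblock ?covP // sameE.
    exists [ffun B => f (rep B)].
      rewrite inE; apply/injectiveP => B B'; rewrite !ffunE => /eqP.
      by rewrite -blkE => /eqP; rewrite !repP.
    by apply/ffunP => x; rewrite !ffunE; apply/eqP; rewrite -blkE repP.
  rewrite inE => /injectiveP g_inj ->.
  have blkE x y : (y \in pblock P x) = (phi g x == phi g y).
    rewrite !ffunE (inj_eq g_inj) -val_eqE /= eq_pblock ?covP //.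
  apply/setP=> B; apply/imsetP/idP => [[x _ ->] | BP].
    rewrite (_ : [set _ in _ | _] = pblock P x) //.
    by apply/setP=> y; rewrite blkE !inE.
  have [x xB] := neP (Sub B BP : D); rewrite /= in xB.
  exists x => //; rewrite -{1}(def_pblock trP BP xB).
  by apply/setP=> y; rewrite blkE !inE.
rewrite card_imset => [|g g' /ffunP e]; last first.
  by apply/ffunP=> B; have := e (rep B); rewrite !ffunE repP.
by rewrite card_inj_ffuns card_sig.
Qed.

Definition proper_coloring (G : sgraph) (C : finType) (f : {ffun G -> C}) : bool :=
  [forall x, forall y, adj x y ==> (f x != f y)].

Lemma proper_coloringP (G : sgraph) (C : finType) (f : {ffun G -> C}) :
  reflect (forall x y, adj x y -> f x != f y) (proper_coloring f).
Proof.
apply: (iffP forallP) => [h x y|h x]; first by have /forallP/(_ y)/implyP := h x.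
by apply/forallP => y; apply/implyP; apply: h.
Qed.

Definition colorings (G : sgraph) (k : nat) : nat :=
  #|[set f : {ffun G -> 'I_k} | proper_coloring f]|.

Lemma proper_coloring_preim (G : sgraph) (C : finType) (f : {ffun G -> C}) :
  proper_coloring f = [forall A in preim_partition f [set: G], stable A].
Proof.
apply/proper_coloringP/forall_inP => [h A /imsetP[x _ ->] | h x y xy].
  apply/forall_inP => y; rewrite !inE /= => /eqP xy.
  apply/forall_inP => z; rewrite !inE /= => /eqP xz.
  by apply/negP => /h; rewrite -xy -xz eqxx.
have /h /forall_inP/(_ x) : [set z in [set: G] | f x == f z]
    \in preim_partition f [set: G] by apply/imsetP; exists x.
rewrite !inE eqxx => /(_ isT) /forall_inP /(_ y).
by rewrite !inE xy /=; case: eqP => // _ /(_ isT).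
Qed.

Lemma partition_card_bounds (T : finType) (P : {set {set T}}) : (0 < #|T|)%N ->
  partition P [set: T] -> (0 < #|P| < #|T|.+1)%N.
Proof.
move=> T_gt0 partP; have := card_partition partP.
case/and3P: partP => /eqP covP _ P0 cardT.
apply/andP; split.
  rewrite lt0n; apply: contraTneq T_gt0 => /eqP; rewrite cards_eq0 => /eqP P00.
  by rewrite -cardsT cardT P00 big_set0.
rewrite ltnS -cardsT cardT -sum1_card; apply: leq_sum => A AP.
by rewrite card_gt0; apply: contraNneq P0 => <-.
Qed.

(** Colorings are sorted by their fibre partition, which has stable blocks exactly when the coloring
    is proper. So the numbers [S_ G j] are the coefficients of the chromatic polynomial in the basis
    of falling factorials. *)
Lemma colorings_ffact (G : sgraph) k : (0 < #|G|)%N ->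
  colorings G k = (\sum_(1 <= j < #|G|.+1) S_ G j * k ^_ j)%N.
Proof.
move=> G_gt0; rewrite /colorings -sum1_card.
pose stP (P : {set {set G}}) :=
  partition P [set: G] && [forall A in P, stable A].
rewrite (partition_big (fun f : {ffun G -> 'I_k} => preim_partition f [set: G]) stP);
  last first.
  move=> f; rewrite inE => prop_f; rewrite /stP -proper_coloring_preim prop_f.
  by rewrite preim_partitionP.
transitivity (\sum_(P | stP P) k ^_ #|P|)%N.
  apply: eq_bigr => P /andP[partP stabP].
  have := card_preim_partition 'I_k partP; rewrite card_ord => <-.
  rewrite -sum1_card.
  apply: eq_bigl => f; rewrite !inE; case: eqP => [eP|]; last by rewrite andbF.
  by rewrite proper_coloring_preim eP stabP.
under [RHS]eq_bigr do rewrite /S_ -sum_nat_const.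
rewrite (exchange_big_dep stP) /=; last first.
  by move=> j P _; rewrite inE => /and3P[p1 _ p2]; rewrite /stP p1.
apply: eq_bigr => P stPP; have /andP[p1 p2] := stPP.
rewrite (eq_bigl (fun j => j == #|P|)) => [|j]; last first.
  by rewrite inE p1 p2 andbT eq_sym.
by rewrite big_nat1_eq partition_card_bounds.
Qed.

Definition color_fun (G : sgraph) (x : nat) : rat := (colorings G x)%:R.

(** The factor [0 < j] clears index 0: [B_] and [T_] sum from 1, [ffact_poly] from 0. *)
Definition part_coef (G : sgraph) (j : nat) : rat := ((0 < j) * S_ G j)%N%:R.

Lemma color_fun_ffact (G : sgraph) : (0 < #|G|)%N ->
  color_fun G =1 ffact_poly #|G|.+1 (part_coef G).
Proof.
move=> G_gt0 x; rewrite /color_fun colorings_ffact // /ffact_poly.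
rewrite big_ord_recl /part_coef mul0n mul0r add0r big_add1 /= big_mkord natr_sum.
by apply: eq_bigr => i _; rewrite mul1n natrM.
Qed.

Lemma coef_mass_part (G : sgraph) : coef_mass #|G|.+1 (part_coef G) = (B_ G)%:R.
Proof.
rewrite /coef_mass /part_coef big_ord_recl mul0n add0r /B_ big_add1 /= big_mkord.
by rewrite natr_sum; apply: eq_bigr => i _; rewrite mul1n.
Qed.

Lemma coef_moment_part (G : sgraph) : coef_moment #|G|.+1 (part_coef G) = (T_ G)%:R.
Proof.
rewrite /coef_moment /part_coef big_ord_recl mul0r add0r /T_ big_add1 /= big_mkord.
by rewrite natr_sum; apply: eq_bigr => i _; rewrite mul1n natrM.
Qed.

(** If every [S_ G j] vanished there would be no proper coloring with [#|G|] colors, but giving all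
    vertices different colors is one. *)
Lemma B_gt0 (G : sgraph) : (0 < #|G|)%N -> (0 < B_ G)%N.
Proof.
move=> G_gt0; rewrite lt0n; apply/eqP => B0.
have : (0 < colorings G #|G|)%N.
  apply/card_gt0P; exists [ffun x => enum_rank x]; rewrite inE.
  apply/proper_coloringP => x y; rewrite !ffunE (inj_eq enum_rank_inj).
  by apply: contraTneq => ->; rewrite adj_irr.
rewrite colorings_ffact // big_nat big1 // => j hj.
suff -> : S_ G j = 0%N by [].
apply/eqP; rewrite -leqn0 -B0 /B_ (bigD1_seq j) ?iota_uniq ?leq_addr //=.
by rewrite mem_index_iota.
Qed.

Lemma A_lt_cross (G H : sgraph) (d : rat) (N0 : nat) :
  (0 < #|G|)%N -> (0 < #|H|)%N -> 0 < d ->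
  (forall N, (N0 <= N)%N -> cross_sum (color_fun G) (color_fun H) N <= - d) ->
  A_ G < A_ H.
Proof.
move=> G0 H0 d0 hN.
have := gap_lt0 (color_fun_ffact G0) (color_fun_ffact H0) d0 hN.
rewrite !coef_mass_part !coef_moment_part subr_lt0 => h.
rewrite /A_ ltr_pdivrMr ?ltr0n ?B_gt0 // mulrAC ltr_pdivlMr ?ltr0n ?B_gt0 //.
by rewrite [ltRHS]mulrC.
Qed.

Lemma A_coef (G : sgraph) n c : (0 < #|G|)%N -> color_fun G =1 ffact_poly n c ->
  coef_mass n c != 0 -> A_ G = coef_moment n c / coef_mass n c.
Proof.
move=> G0 e nz.
have := gap_eq0 (color_fun_ffact G0) e (fun=> erefl).
rewrite coef_mass_part coef_moment_part => /eqP; rewrite subr_eq0 => /eqP h.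
rewrite /A_; apply/eqP; rewrite eqr_div ?pnatr_eq0 -?lt0n ?B_gt0 //.
by rewrite h mulrC.
Qed.

Lemma eq_A (G H : sgraph) : (0 < #|G|)%N -> (0 < #|H|)%N ->
  color_fun G =1 color_fun H -> A_ G = A_ H.
Proof.
move=> G0 H0 e.
rewrite (A_coef G0 (n := #|H|.+1) (c := part_coef H)).
- by rewrite coef_mass_part coef_moment_part.
- by move=> x; rewrite e color_fun_ffact.
by rewrite coef_mass_part pnatr_eq0 -lt0n B_gt0.
Qed.

Lemma color_fun_iso (G H : sgraph) : isomorphic G H -> color_fun G =1 color_fun H.
Proof.
case=> f [g fK gK] fadj k; congr _%:R.
pose phi (c : {ffun H -> 'I_k}) : {ffun G -> 'I_k} := [ffun x => c (f x)].
have phi_inj : injective phi.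
  by move=> c c' /ffunP e; apply/ffunP=> y; have := e (g y); rewrite !ffunE gK.
rewrite /colorings -(card_imset _ phi_inj); apply/eq_card => c; rewrite inE.
apply/proper_coloringP/imsetP => [hc | [c' /[!inE] /proper_coloringP hc' ->] x y].
  exists [ffun y => c (g y)]; last by apply/ffunP=> x; rewrite !ffunE fK.
  rewrite inE; apply/proper_coloringP => x y xy; rewrite !ffunE; apply: hc.
  by rewrite -fadj !gK.
by rewrite !ffunE -fadj; apply: hc'.
Qed.

Lemma color_fun_union (G H : sgraph) x :
  color_fun (disjoint_union G H) x = color_fun G x * color_fun H x.
Proof.
rewrite /color_fun -natrM; congr _%:R; rewrite /colorings -cardsX.
pose phi (p : {ffun G -> 'I_x} * {ffun H -> 'I_x}) :
    {ffun disjoint_union G H -> 'I_x} :=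
  [ffun u => match u with inl a => p.1 a | inr b => p.2 b end].
have phi_inj : injective phi.
  move=> [c d] [c' d'] /ffunP e; congr (_, _); apply/ffunP => z.
    by have := e (inl z); rewrite !ffunE.
  by have := e (inr z); rewrite !ffunE.
rewrite -(card_imset _ phi_inj); apply/eq_card => c; rewrite inE.
apply/proper_coloringP/imsetP => [hc | [[c1 c2] /[!inE] /andP[/proper_coloringP h1 /proper_coloringP h2] ->]].
  exists ([ffun a => c (inl a)], [ffun b => c (inr b)]).
    rewrite !inE; apply/andP; split; apply/proper_coloringP => a b ab; rewrite !ffunE;
    exact: hc.
  by apply/ffunP=> -[a|b]; rewrite !ffunE.
by case=> a [] b //=; rewrite !ffunE //=; [apply: h1 | apply: h2].
Qed.

Lemma color_fun_empty (G : sgraph) x : #|G| = 0%N -> color_fun G x = 1.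
Proof.
move=> G0; rewrite /color_fun /colorings (_ : [set _ | _] = setT).
  by rewrite cardsT card_ffun G0 expn0.
by apply/setP=> f; rewrite !inE; apply/proper_coloringP => a; have /card0_eq/(_ a) := G0.
Qed.

(** * Chromatic polynomials of paths and cycles *)

Lemma big_tuple_cons (C : finType) m (F : m.+1.-tuple C -> rat) :
  \sum_t F t = \sum_a \sum_(t : m.-tuple C) F [tuple of a :: t].
Proof.
rewrite pair_big /=.
rewrite (reindex (fun p : C * m.-tuple C => [tuple of p.1 :: p.2])) //=.
exists (fun t => (thead t, [tuple of behead t])) => [[a t] _|t _] /=.
  by congr (_, _); apply: val_inj.
by rewrite -tuple_eta.
Qed.

(** As tuples, colorings of a path or cycle become walks in the complete graph on the colors, which
    can be counted by induction on the first entry. *)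
Lemma colorings_ord_tuple m (G : sgraph) (e : rel 'I_m) esym eirr k :
  G = @SGraph 'I_m e esym eirr ->
  color_fun G k = \sum_(t : m.-tuple 'I_k)
     [forall i, forall j, e i j ==> (tnth t i != tnth t j)]%:R.
Proof.
move=> ->; rewrite /color_fun /colorings -sum1_card natr_sum big_mkcond /=.
rewrite (reindex (fun t : m.-tuple 'I_k => [ffun i => tnth t i])) /=; last first.
  exists (fun f : {ffun 'I_m -> 'I_k} => [tuple f i | i < m]) => [t _|f _].
    by apply: eq_from_tnth => i; rewrite tnth_mktuple ffunE.
  by apply/ffunP => i; rewrite ffunE tnth_mktuple.
apply: eq_bigr => t _; rewrite inE.
have -> : proper_coloring (G := SGraph esym eirr) [ffun i => tnth t i] =
    [forall i, forall j, e i j ==> (tnth t i != tnth t j)].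
  by apply: eq_forallb => i; apply: eq_forallb => j; rewrite !ffunE.
by case: [forall i, _].
Qed.

Section PathGraph.
Variable m : nat.

Definition path_adj : rel 'I_m := fun i j => (j == i.+1 :> nat) || (i == j.+1 :> nat).

Lemma path_adj_sym : symmetric path_adj.
Proof. by move=> i j; rewrite /path_adj orbC. Qed.

Lemma path_adj_irr : irreflexive path_adj.
Proof. by move=> i; rewrite /path_adj orbb ltn_eqF. Qed.

Definition path_graph : sgraph := SGraph path_adj_sym path_adj_irr.
End PathGraph.

Section Walks.
Variable k : nat.
Let neq : rel 'I_k := fun a b => a != b.

Lemma sum_neq (f : 'I_k -> rat) a :
  \sum_c (a != c)%:R * f c = \sum_c f c - f a.
Proof.
rewrite [in RHS](bigD1 a) //= addrC addrK (bigD1 a) //= eqxx mul0r add0r.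
by apply: eq_bigr => c ca; rewrite eq_sym ca mul1r.
Qed.

Lemma walk_count m a :
  \sum_(t : m.-tuple 'I_k) (path neq a t)%:R = (k%:R - 1) ^+ m :> rat.
Proof.
elim: m a => [|m IH] a.
  by rewrite (big_pred1 [tuple]) // => t; apply/esym/eqP; apply: tuple0.
rewrite big_tuple_cons.
under eq_bigr => c _ do under eq_bigr => t _ do rewrite /= -mulnb natrM.
under eq_bigr => c _ do rewrite -mulr_sumr IH.
by rewrite sum_neq sumr_const card_ord exprS -mulr_natl; ring.
Qed.

(** These are the walks of length [m + 1] from [a] to [b] in the complete graph on [k] vertices,
    whose adjacency matrix has eigenvalues [k - 1] and [-1]. The factor [k] avoids a division. *)
Lemma closed_walk_count m a b : (k%:R *
  \sum_(t : m.-tuple 'I_k) (path neq a t && neq (last a t) b)%:R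
  = (k%:R - 1) ^+ m.+1 + (-1) ^+ m - k%:R * (-1) ^+ m * (a == b)%:R :> rat).
Proof.
elim: m a => [|m IH] a.
  rewrite (big_pred1 [tuple]) => [|t]; last by apply/esym/eqP; apply: tuple0.
  by rewrite /= /neq; case: eqP => _ /=; ring.
rewrite big_tuple_cons.
under eq_bigr => c _ do under eq_bigr => t _ do rewrite /= -andbA -mulnb natrM.
under eq_bigr => c _ do rewrite -mulr_sumr.
rewrite mulr_sumr.
under eq_bigr => c _ do rewrite mulrCA IH.
rewrite sum_neq sumrB sumr_const card_ord -mulr_sumr.
have -> : \sum_(c < k) (c == b)%:R = 1 :> rat.
  by rewrite (bigD1 b) //= eqxx big1 ?addr0 // => c /negPf->.
by rewrite -mulr_natl !exprS; ring.
Qed.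
End Walks.

Lemma color_fun_path m x : color_fun (path_graph m.+1) x = x%:R * (x%:R - 1) ^+ m.
Proof.
rewrite (@colorings_ord_tuple m.+1 _ _ (@path_adj_sym _) (@path_adj_irr _)) //.
rewrite big_tuple_cons.
transitivity (\sum_(a < x) \sum_(t : m.-tuple 'I_x)
                 (path (fun u v => u != v) a t)%:R : rat); last first.
  by under eq_bigr do rewrite walk_count; rewrite sumr_const card_ord mulr_natl.
apply: eq_bigr => a _; apply: eq_bigr => t _; congr (nat_of_bool _)%:R.
apply/forallP/(pathP a) => [h i it | h i].
  have {}it : (i < m)%N by move: it; rewrite size_tuple.
  have h1 : (i < m.+1)%N by lia.
  have h2 : (i.+1 < m.+1)%N by lia.
  have /forallP/(_ (Ordinal h2)) := h (Ordinal h1).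
  by rewrite /path_adj /= eqxx /= !(tnth_nth a).
apply/forallP => j; apply/implyP; rewrite !(tnth_nth a) => /orP[]/eqP e.
  by rewrite e /=; apply: h; rewrite size_tuple; have := ltn_ord j; lia.
by rewrite e eq_sym /=; apply: h; rewrite size_tuple; have := ltn_ord i; lia.
Qed.

Lemma color_fun_cycle m x :
  color_fun (C_ m.+2) x = (x%:R - 1) ^+ m.+2 + (-1) ^+ m.+2 * (x%:R - 1).
Proof.
rewrite (@colorings_ord_tuple m.+2 _ _ (@cycle_adj_sym _) (@cycle_adj_irr _)) //.
rewrite big_tuple_cons.
transitivity (\sum_(a < x) \sum_(t : m.+1.-tuple 'I_x)
  (path (fun u v => u != v) a t && (last a t != a))%:R : rat); last first.
  case: x => [|x]; first by rewrite big_ord0 sub0r mulrN1 subrr.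
  have x0 : x.+1%:R != 0 :> rat by rewrite pnatr_eq0.
  apply: (mulfI x0); rewrite mulr_sumr.
  under eq_bigr do rewrite closed_walk_count eqxx.
  by rewrite sumr_const card_ord -[LHS]mulr_natl !exprS /=; ring.
apply: eq_bigr => a _; apply: eq_bigr => t _; congr (nat_of_bool _)%:R.
have ht : size t = m.+1 by rewrite size_tuple.
apply/forallP/andP => [h | [/(pathP a) h1 h2] i].
  split.
    apply/(pathP a) => i; rewrite ht => it.
    have h1 : (i < m.+2)%N by lia.
    have h2 : (i.+1 < m.+2)%N by lia.
    have /forallP/(_ (Ordinal h2)) := h (Ordinal h1).
    rewrite /cycle_adj -val_eqE /= modn_small // eqxx /= !(tnth_nth a) /=.
    by rewrite ltn_eqF.
  have /forallP/(_ ord0) := h ord_max.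
  rewrite /cycle_adj -val_eqE /= modnn /= !(tnth_nth a) /=.
  by rewrite (last_nth a) ht.
(* The cyclic successor is the next entry of the walk or, after the last entry, its starting point;
   the closing condition [h2] covers the latter. *)
have key (i' j' : 'I_m.+2) : nat_of_ord j' = (i'.+1 %% m.+2)%N ->
    tnth [tuple of a :: t] i' != tnth [tuple of a :: t] j'.
  rewrite !(tnth_nth a) => ->; have := ltn_ord i'.
  case: (ltngtP i' m.+1) => hi hi'; last 2 first.
  - lia.
  - by move: h2; rewrite hi modnn /= (last_nth a) ht.
  by rewrite modn_small //=; apply: h1; rewrite ht.
apply/forallP => j; apply/implyP; rewrite /cycle_adj => /andP[_ /orP[]/eqP e].
  exact: key.
by rewrite eq_sym; apply: key.
Qed.

(** * Isomorphisms and decomposition into paths and cycles *)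

Lemma iso_refl (G : sgraph) : isomorphic G G.
Proof. by exists id => //; exists id. Qed.

Lemma iso_sym (G H : sgraph) : isomorphic G H -> isomorphic H G.
Proof.
case=> f [g fK gK] fadj; exists g; first by exists f.
by move=> x y; rewrite -fadj !gK.
Qed.

Lemma iso_trans (G H K : sgraph) :
  isomorphic G H -> isomorphic H K -> isomorphic G K.
Proof.
case=> f bf fadj [g bg gadj]; exists (g \o f); first exact: bij_comp.
by move=> x y /=; rewrite gadj fadj.
Qed.

Lemma iso_empty (G H : sgraph) : #|G| = 0%N -> #|H| = 0%N -> isomorphic G H.
Proof.
move=> G0 H0; have noG (x : G) : False by have := card0_eq G0 x.
exists (fun x : G => False_rect H (noG x)); last by move=> x; case: (noG x).
apply: inj_card_bij; first by move=> x; case: (noG x).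
by rewrite H0.
Qed.

Lemma iso_union (G G' H H' : sgraph) : isomorphic G G' -> isomorphic H H' ->
  isomorphic (disjoint_union G H) (disjoint_union G' H').
Proof.
case=> f [f' fK fK'] fadj [g [g' gK gK'] gadj].
exists (fun u : disjoint_union G H =>
  match u with inl x => inl (f x) | inr y => inr (g y) end
  : disjoint_union G' H').
  exists (fun u => match u with inl x => inl (f' x) | inr y => inr (g' y) end).
    by case=> x; rewrite ?fK ?gK.
  by case=> x; rewrite ?fK' ?gK'.
by case=> x [] y /=; rewrite ?fadj ?gadj.
Qed.

Lemma iso_union_swap (G H K : sgraph) :
  isomorphic (disjoint_union G (disjoint_union H K))
             (disjoint_union H (disjoint_union G K)).
Proof.
pose sw (A B C : Type) (u : A + (B + C)) : B + (A + C) :=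
  match u with
  | inl x => inr (inl x)
  | inr (inl y) => inl y
  | inr (inr z) => inr (inr z)
  end.
exists (sw G H K : disjoint_union G (disjoint_union H K) ->
                   disjoint_union H (disjoint_union G K)).
  by exists (sw H G K); case=> [|[]].
by case=> [x|[x|x]] [y|[y|y]].
Qed.

Lemma iso_union_comm (G H : sgraph) :
  isomorphic (disjoint_union G H) (disjoint_union H G).
Proof.
pose sw (A B : Type) (u : A + B) : B + A :=
  match u with inl x => inr x | inr y => inl y end.
exists (sw G H : disjoint_union G H -> disjoint_union H G).
  by exists (sw H G); case.
by case=> x [] y.
Qed.

(** The Boolean tells cycles from paths. [K_3] is encoded as a cycle, [K_1] and [K_2] as paths, so
    that unions of paths and cycles become plain lists, compared up to permutation. *)
Definition component (c : bool * nat) : sgraph :=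
  if c.1 then C_ c.2 else path_graph c.2.

Definition valid (c : bool * nat) : bool := ((if c.1 then 3 else 1) <= c.2)%N.

Definition graph_of (s : seq (bool * nat)) : sgraph :=
  foldr (fun c H => disjoint_union (component c) H) (K_ 0) s.

Definition order_of (s : seq (bool * nat)) : nat := sumn (map snd s).

Lemma card_component c : #|component c| = c.2.
Proof. by case: c => [[] m] /=; rewrite card_ord. Qed.

Lemma card_graph_of s : #|graph_of s| = order_of s.
Proof.
elim: s => [|c s IH]; first by rewrite card_ord.
by rewrite card_sum IH card_component.
Qed.

Lemma iso_graph_of_cons_cat s1 c s2 :
  isomorphic (graph_of (s1 ++ c :: s2)) (graph_of (c :: s1 ++ s2)).
Proof.
elim: s1 => [|d s1 IH]; first exact: iso_refl.
apply: iso_trans (iso_union_swap _ _ _).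
exact: (iso_union (iso_refl _) IH).
Qed.

Lemma iso_perm s t : perm_eq s t -> isomorphic (graph_of s) (graph_of t).
Proof.
elim: s t => [|c s IH] t st.
  have /perm_nilP-> : perm_eq t [::] by rewrite perm_sym.
  exact: iso_refl.
have ct : c \in t by rewrite -(perm_mem st) mem_head.
case/splitPr: ct st => t1 t2 st; apply: iso_trans (iso_sym (iso_graph_of_cons_cat _ _ _)).
apply: (iso_union (iso_refl _)); apply: IH.
by move: st; rewrite perm_sym -[c :: t2]cat1s perm_catCA perm_cons perm_sym.
Qed.

Lemma iso_copiesS p (H : sgraph) :
  isomorphic (copies p.+1 H) (disjoint_union H (copies p H)).
Proof.
apply: iso_sym.
exists (fun u : disjoint_union H (copies p H) =>
  match u with inl x => (ord0, x) | inr v => (lift ord0 v.1, v.2) end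
  : copies p.+1 H).
  exists (fun w : copies p.+1 H =>
    match unlift ord0 w.1 with None => inl w.2 | Some i => inr (i, w.2) end
    : disjoint_union H (copies p H)).
    by case=> [x|[i x]] /=; rewrite ?unlift_none ?liftK.
  by case=> i x /=; case: unliftP => [j|] ->.
by case=> [x|[i x]] [y|[j y]].
Qed.

Lemma iso_copies_triangle p :
  isomorphic (copies p (K_ 3)) (graph_of (nseq p (true, 3%N))).
Proof.
elim: p => [|p IH]; first by apply: iso_empty; rewrite ?card_prod card_ord.
apply: iso_trans (iso_copiesS _ _) _; apply: iso_union IH.
exists (id : K_ 3 -> C_ 3); first by exists id.
by case=> [[|[|[|i]]] hi] // [[|[|[|j]]] hj].
Qed.

(** * Splitting off one component of a graph of degree at most 2 *)

Section Induced.
Variables (G : sgraph) (A : {set G}).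

Definition induced_adj : rel {x : G | x \in A} := fun u v => adj (val u) (val v).

Lemma induced_adj_sym : symmetric induced_adj.
Proof. by move=> u v; apply: adj_sym. Qed.

Lemma induced_adj_irr : irreflexive induced_adj.
Proof. by move=> u; apply: adj_irr. Qed.

Definition induced : sgraph := SGraph induced_adj_sym induced_adj_irr.

Lemma degree_induced (u : induced) : (degree u <= degree (val u))%N.
Proof.
rewrite /degree -(card_imset _ val_inj); apply: subset_leq_card.
by apply/subsetP => _ /imsetP[v + ->]; rewrite !inE.
Qed.
End Induced.

Lemma degree2_nbr (G : sgraph) (x y1 y2 z : G) : (degree x <= 2)%N ->
  adj x y1 -> adj x y2 -> y1 != y2 -> adj x z -> z = y1 \/ z = y2.
Proof.
move=> d2 a1 a2 n12 az.
have sub : [set y1; y2] \subset [set y | adj x y].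
  by apply/subsetP => w; rewrite !inE => /orP[]/eqP->.
have /eqP e : [set y1; y2] == [set y | adj x y].
  by rewrite eqEcard sub cards2 n12.
have : z \in [set y1; y2] by rewrite e inE.
by rewrite !inE => /orP[]/eqP->; [left | right].
Qed.

Lemma longest_path (G : sgraph) : (0 < #|G|)%N ->
  exists p : seq G, [/\ (0 < size p)%N, uniq p, sorted (@adj G) p &
    forall q : seq G, uniq q -> sorted (@adj G) q -> (size q <= size p)%N].
Proof.
move=> /card_gt0P[x _].
pose P m := [exists t : m.-tuple G, uniq t && sorted (@adj G) t].
have P1 : P 1%N by apply/existsP; exists [tuple x].
have exP : exists m, P m by exists 1%N.
have ubP m : P m -> (m <= #|G|)%N.
  case/existsP => t /andP[ut _]; rewrite -(size_tuple t).
  by rewrite -(card_uniqP ut) max_card.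
have [m /existsP[t /andP[ut st]] mmax] := ex_maxnP exP ubP.
exists t; split => //; first by rewrite size_tuple mmax.
move=> q uq sq; rewrite size_tuple; apply: mmax.
by apply/existsP; exists (in_tuple q); rewrite /= uq.
Qed.

Lemma iso_split (G : sgraph) (x0 : G) (p : seq G) (e : rel 'I_(size p))
    (esym : symmetric e) (eirr : irreflexive e) :
  uniq p -> (forall i j : 'I_(size p), adj (nth x0 p i) (nth x0 p j) = e i j) ->
  (forall x z, x \in p -> adj x z -> z \in p) ->
  isomorphic G (disjoint_union (SGraph esym eirr) (induced (~: [set x in p]))).
Proof.
move=> up padj pclosed; apply: iso_sym.
set H := induced _.
pose f (u : disjoint_union (SGraph esym eirr) H) : G :=
  match u with inl i => nth x0 p i | inr w => val w end.
have inp (i : 'I_(size p)) : nth x0 p i \in p by apply: mem_nth.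
have outp (w : H) : val w \notin p by have := valP w; rewrite !inE.
exists f.
  apply: inj_card_bij.
    move=> [i|w] [j|w'] /= eq_f.
    - have -> // : i = j.
      apply: val_inj; apply/eqP; rewrite -(nth_uniq x0 _ _ up) //=.
      exact/eqP.
    - by have := outp w'; rewrite /= -eq_f inp.
    - by have := outp w; rewrite /= eq_f inp.
    - by have -> : w = w' by apply: val_inj.
  rewrite card_sum card_ord /= card_sig.
  rewrite -(cardC [in p]) (card_uniqP up) leq_add2l; apply/eq_leq/eq_card => x.
  by rewrite !inE.
case=> [i|w] [j|w'] //=.
- apply/negP => a; have := outp w'; rewrite /= (pclosed _ _ _ a) //.
- by apply/negP; rewrite adj_sym => a; have := outp w; rewrite /= (pclosed _ _ _ a).
Qed.

(** The vertices of a longest path form a whole component: an inner vertex has its two neighbours on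
    the path, and a new neighbour of an end would lengthen the path. The component is a cycle if the
    two ends are adjacent and a path otherwise. *)
Lemma split_component (G : sgraph) :
  (0 < #|G|)%N -> (forall x : G, degree x <= 2)%N ->
  exists c (H : sgraph), [/\ valid c, isomorphic G (disjoint_union (component c) H) &
    forall x : H, (degree x <= 2)%N].
Proof.
move=> G0 d2; have [p [p0 up sp pmax]] := longest_path G0.
have [x0 _] := card_gt0P G0.
set m := size p; pose v i := nth x0 p i.
have vadj i : (i.+1 < m)%N -> adj (v i) (v i.+1).
  by move=> im; apply: (sortedP x0 sp).
have vadj' i : (0 < i < m)%N -> adj (v i) (v i.-1).
  case: i => // i im; rewrite adj_sym; exact: vadj.
have vinj i j : (i < m)%N -> (j < m)%N -> v i = v j -> i = j.
  by move=> im jm /eqP; rewrite nth_uniq // => /eqP.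
have vnbr i z : (0 < i)%N -> (i.+1 < m)%N -> adj (v i) z ->
    z = v i.-1 \/ z = v i.+1.
  move=> i0 im; apply: degree2_nbr => //; rewrite ?vadj ?vadj' ?i0 //.
    exact: ltnW.
  by apply/eqP => /vinj; lia.
have closed x z : x \in p -> adj x z -> z \in p.
  move=> xp xz; apply/contraT => zp.
  have im := xp; rewrite -index_mem in im.
  have ex : v (index x p) = x by apply: nth_index.
  move: (index x p) im ex => i im ex; rewrite -ex in xz => {ex x xp}.
  (* At the first vertex [z] is prepended, at the last one it is appended; both contradict
     maximality. *)
  have [i0|i0] := posnP i.
    have := pmax (z :: p); rewrite /= zp up ltnn => /(_ isT) h; suff: false by []; apply: h.
    move: p0 sp xz; rewrite /v i0; case: (p) => //= a q _ -> az.
    by rewrite adj_sym az.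
  case: (ltngtP i.+1 m) => im'; last 2 first.
  - by move: im'; rewrite ltnNge im.
  - have := pmax (rcons p z); rewrite rcons_uniq zp up size_rcons ltnn.
    move=> /(_ isT) h; suff: false by []; apply: h.
    move: im' sp xz; rewrite /v /m; case: (p) => //= a q [->] sp.
    by rewrite rcons_path sp (last_nth x0).
  have [e|e] := vnbr i z i0 im' xz; move: zp; rewrite e mem_nth //.
  by apply: leq_ltn_trans im; apply: leq_pred.
have chord i j : (i < j < m)%N -> adj (v i) (v j) ->
    j = i.+1 \/ (i = 0%N /\ j = m.-1).
  move=> /andP[ij jm] a; have [i0|i0] := posnP i; last first.
    have [|e|e] := vnbr i (v j) i0 _ a; first lia.
      by have := vinj _ _ jm _ e; lia.
    by left; apply: vinj e => //; lia.
  have [?|jm'] := eqVneq j m.-1; first by right.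
  left; rewrite adj_sym in a; have [||e|e] := vnbr j (v i) _ _ a; try lia.
    by have := vinj _ _ _ _ e; lia.
  by have := vinj _ _ _ _ e; lia.
pose H := induced (~: [set x in p]).
have dH (x : H) : (degree x <= 2)%N by apply: leq_trans (degree_induced _) (d2 _).
have sym_ext (e : rel 'I_m) : symmetric e -> irreflexive e ->
    (forall i j : 'I_m, (i < j)%N -> adj (v i) (v j) = e i j) ->
    forall i j : 'I_m, adj (v i) (v j) = e i j.
  move=> es ei h i j; case: (ltngtP i j) => ij; first exact: h.
    by rewrite adj_sym es h.
  by have -> : i = j by [apply: val_inj]; rewrite adj_irr ei.
(* The only possible chord joins the two ends; [2 < m] sets apart the single edge, whose ends are
   adjacent already. *)
have [/andP[m3 a0]|nocyc] := boolP ((2 < m)%N && adj (v 0) (v m.-1)).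
  exists (true, m), H; split => //; apply: iso_split => //.
  apply: (sym_ext _ (@cycle_adj_sym m) (@cycle_adj_irr m)) => i j ij.
  have jm := ltn_ord j; have cij := chord i j.
  rewrite ij jm in cij; have {}cij := cij isT.
  rewrite /cycle_adj -val_eqE /= (ltn_eqF ij) /=.
  have i1 : (i.+1 < m)%N by lia.
  rewrite (modn_small i1).
  have [ej|nej] := eqVneq (nat_of_ord j) i.+1.
    by rewrite /= ej vadj.
  rewrite /=; have [ej|nej'] := eqVneq j.+1 m.
    rewrite ej modnn; have [i0|i0] := eqVneq (nat_of_ord i) 0%N.
      by rewrite i0; have -> : nat_of_ord j = m.-1 by lia.
    by apply/negP => a; have := cij a; lia.
  rewrite modn_small; last by lia.
  by rewrite [RHS](_ : _ = false); [apply/negP => a; have := cij a; lia | lia].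
exists (false, m), H; split => //; apply: iso_split => //.
apply: (sym_ext _ (@path_adj_sym m) (@path_adj_irr m)) => i j ij.
have jm := ltn_ord j; rewrite /path_adj.
have [ej|nej] := eqVneq (nat_of_ord j) i.+1; first by rewrite /= ej vadj -?ej.
rewrite [RHS](_ : _ = false); last by lia.
apply/negP => a; have [||[i0 jm1]] := chord i j _ a; first by rewrite ij jm.
  by lia.
by move: nocyc; rewrite i0 jm1 in a; rewrite a andbT; lia.
Qed.

Lemma decomposition (G : sgraph) : (forall x : G, degree x <= 2)%N ->
  exists s, all valid s /\ isomorphic G (graph_of s).
Proof.
move: {2}(#|G|) (leqnn #|G|) => k; elim: k G => [|k IH] G Gk d2.
  by exists [::]; split => //; apply: iso_empty; rewrite ?card_ord //; lia.
have [G0|G0] := posnP #|G|; first by apply: (IH G) => //; rewrite G0.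
have [c [H [vc GH dH]]] := split_component G0 d2.
have [|s [vs Hs]] := IH H _ dH.
  (* A valid component has at least one vertex, so the order decreases. *)
  case: GH => f /bij_eq_card; rewrite card_sum card_component => e _.
  by move: vc; rewrite /valid; case: (c.1); lia.
exists (c :: s); split; first by rewrite /= vc.
exact: iso_trans GH (iso_union (iso_refl _) Hs).
Qed.

(** * Comparisons with a monotone ratio *)

(* The chromatic polynomial at [y + 1]. *)
Definition component_poly (c : bool * nat) (y : rat) : rat :=
  if c.1 then y ^+ c.2 + (-1) ^+ c.2 * y else (y + 1) * y ^+ c.2.-1.

Definition list_poly (s : seq (bool * nat)) (y : rat) : rat :=
  \prod_(c <- s) component_poly c y.

Lemma color_fun_component c x : valid c ->
  color_fun (component c) x = component_poly c (x%:R - 1).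
Proof.
case: c => -[] [|[|m]] // _; rewrite /component /component_poly /=.
- by rewrite color_fun_cycle.
- by rewrite color_fun_path subrK.
- by rewrite color_fun_path subrK.
Qed.

Lemma color_fun_graph_of s x : all valid s ->
  color_fun (graph_of s) x = list_poly s (x%:R - 1).
Proof.
elim: s => [|c s IH] /=.
  by rewrite color_fun_empty ?card_ord // /list_poly big_nil.
case/andP=> vc vs; rewrite color_fun_union IH // color_fun_component //.
by rewrite /list_poly big_cons.
Qed.

Lemma list_poly_cat s t y : list_poly (s ++ t) y = list_poly s y * list_poly t y.
Proof. by rewrite /list_poly big_cat. Qed.

Lemma list_poly_ge0 s (x : nat) : all valid s -> 0 <= list_poly s (x%:R - 1).
Proof. by move=> vs; rewrite -color_fun_graph_of // ler0n. Qed.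

Lemma list_poly_gt0 s (y : rat) : all valid s -> 2 <= y -> 0 < list_poly s y.
Proof.
move=> /allP vs y2; rewrite /list_poly big_seq prodr_gt0 // => -[b m] /vs.
rewrite /valid /component_poly /=; case: b => vm; last first.
  by apply: mulr_gt0; [lra | apply: exprn_gt0; lra].
have h : y < y ^+ m by rewrite -[ltLHS]expr1 ltr_eXn2l ?(ltn_trans _ vm) //; lra.
by rewrite -signr_odd; case: odd; rewrite ?expr1 ?expr0; lra.
Qed.

Lemma list_poly0 s : all valid s -> s != [::] -> list_poly s (0%:R - 1) = 0.
Proof.
case: s => // -[[] m] s /= _ _; rewrite /list_poly big_cons /component_poly /= sub0r.
  by rewrite mulrN1 subrr mul0r.
by rewrite addNr !mul0r.
Qed.

Lemma order_of_gt0 s : all valid s -> s != [::] -> (0 < order_of s)%N.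
Proof.
by case: s => // -[[] m] s /andP[vm _] _; rewrite /order_of /=; move: vm;
  rewrite /valid /=; lia.
Qed.

(** The common part [u] is arbitrary, so that the replacement may be made inside any larger
    graph. *)
Definition better (s t : seq (bool * nat)) : Prop :=
  forall u, all valid u -> A_ (graph_of (s ++ u)) < A_ (graph_of (t ++ u)).

Lemma cross_row_le0 F F' x :
  (forall y, (y < x)%N -> F x * F' y <= F y * F' x) -> cross_row F F' x <= 0.
Proof.
move=> h; rewrite /cross_row; apply: sumr_le0 => y _; have yx := ltn_ord y.
rewrite mulr_le0_ge0 //; last by rewrite invr_ge0 -natrM ler0n.
rewrite mulr_ge0_le0 ?subr_ge0 ?ler_nat 1?ltnW //.
by rewrite subr_le0 h.
Qed.

Lemma cross_row_lt0 F F' x y0 :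
  (forall y, (y < x)%N -> F x * F' y <= F y * F' x) ->
  (y0 < x)%N -> F x * F' y0 < F y0 * F' x -> cross_row F F' x < 0.
Proof.
move=> h yx s; rewrite /cross_row (bigD1 (Ordinal yx)) //=.
apply: ltr_wnDr.
  apply: sumr_le0 => y _; have {}yx := ltn_ord y.
  rewrite mulr_le0_ge0 //; last by rewrite invr_ge0 -natrM ler0n.
  rewrite mulr_ge0_le0 ?subr_ge0 ?ler_nat 1?ltnW //.
  by rewrite subr_le0 h.
rewrite nmulr_rlt0 ?invr_gt0 ?mulr_gt0 ?natfact_gt0 //.
by rewrite pmulr_rlt0 ?subr_gt0 ?ltr_nat // subr_lt0.
Qed.

(* Chebyshev's association inequality, for the Poisson weights multiplied by the
   polynomial of the common part. *)
Lemma better_of_monotone_ratio s t :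
  all valid s -> all valid t -> s != [::] -> t != [::] ->
  (forall x y : nat, (y < x)%N ->
     list_poly s (x%:R - 1) * list_poly t (y%:R - 1) <=
     list_poly s (y%:R - 1) * list_poly t (x%:R - 1)) ->
  list_poly s 4 * list_poly t 3 < list_poly s 3 * list_poly t 4 ->
  better s t.
Proof.
move=> vs vt s0 t0 mono strict u vu.
pose F x := color_fun (graph_of (s ++ u)) x.
pose F' x := color_fun (graph_of (t ++ u)) x.
have FE x : F x = list_poly s (x%:R - 1) * list_poly u (x%:R - 1).
  by rewrite /F color_fun_graph_of ?all_cat ?vs // list_poly_cat.
have FE' x : F' x = list_poly t (x%:R - 1) * list_poly u (x%:R - 1).
  by rewrite /F' color_fun_graph_of ?all_cat ?vt // list_poly_cat.
have monoF x y : (y < x)%N -> F x * F' y <= F y * F' x.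
  move=> yx; rewrite !FE !FE' mulrACA [leRHS]mulrACA [X in _ <= _ * X]mulrC.
  by apply: ler_wpM2r; [apply: mulr_ge0; apply: list_poly_ge0 | apply: mono].
(* One strict pair is enough: 5 and 4 colors, that is the points 4 and 3, where the polynomial of
   [u] is positive. This row provides the margin and is included as soon as [N >= 6]. *)
have row5 : cross_row F F' 5 < 0.
  apply: (cross_row_lt0 (y0 := 4)) => // [y|]; first exact: monoF.
  rewrite !FE !FE' mulrACA [ltRHS]mulrACA [X in _ < _ * X]mulrC.
  have -> : 5%:R - 1 = 4 :> rat by lra.
  have -> : 4%:R - 1 = 3 :> rat by lra.
  by rewrite ltr_pM2r // mulr_gt0 // list_poly_gt0 //; lra.
apply: (@A_lt_cross _ _ (- cross_row F F' 5) 6).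
- by rewrite card_graph_of order_of_gt0 ?all_cat ?vs //; case: (s) s0.
- by rewrite card_graph_of order_of_gt0 ?all_cat ?vt //; case: (t) t0.
- by rewrite oppr_gt0.
move=> N N6; rewrite opprK cross_sum_rows (bigD1 (Ordinal N6)) //= gerDl.
by apply: sumr_le0 => x _; apply: cross_row_le0 => y; apply: monoF.
Qed.

(** [C] is a common factor that vanishes at the integers below [b0], so [g / f] has to increase only
    from [b0] on. Writing the two points as [b0 + u] and [b0 + u + 1 + d] turns this into
    nonnegativity of [r] for nonnegative [u] and [d]. *)
Lemma better_of_factored_ratio (C f g : rat -> rat) (b0 : nat)
    (r : rat -> rat -> rat) s t :
  all valid s -> all valid t -> s != [::] -> t != [::] ->
  list_poly s =1 (fun y => C y * f y) -> list_poly t =1 (fun y => C y * g y) ->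
  (forall n : nat, 0 <= C n%:R) -> 0 < C 3 -> 0 < C 4 ->
  (forall n : nat, (n < b0)%N -> C n%:R = 0) ->
  (forall u d, let b := b0%:R + u in let a := b + 1 + d in
     f b * g a - f a * g b = r u d) ->
  (forall u d, 0 <= u -> 0 <= d -> 0 <= r u d) ->
  f 4 * g 3 < f 3 * g 4 ->
  better s t.
Proof.
move=> vs vt s0 t0 es et C0 C3 C4 Cb rE r0 strict.
apply: better_of_monotone_ratio => //; last first.
  rewrite !es !et mulrACA [ltRHS]mulrACA [X in _ < X * _]mulrC.
  by rewrite ltr_pM2l // mulr_gt0.
(* With 0 colors the point is [-1], where both polynomials vanish. *)
move=> x [|b] bx; first by rewrite !list_poly0 // mulr0 mul0r.
have -> : b.+1%:R - 1 = b%:R :> rat by rewrite -natr1 addrK.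
case: x bx => // a ba; have -> : a.+1%:R - 1 = a%:R :> rat by rewrite -natr1 addrK.
rewrite ltnS in ba; rewrite !es !et mulrACA [leRHS]mulrACA [X in _ <= X * _]mulrC.
case: (ltnP b b0) => bb0; first by rewrite (Cb b) // mulr0 !mul0r.
apply: ler_wpM2l; first by rewrite mulr_ge0.
have := r0 (b - b0)%N%:R (a - b.+1)%N%:R (ler0n _ _) (ler0n _ _).
rewrite -rE subr_ge0 /= -natrD subnKC // -addrA nat1r.
have -> : (a - b.+1).+1 = (a - b)%N by lia.
by rewrite -natrD subnKC // ltnW.
Qed.

Lemma nat_ge0_cases (C : rat -> rat) : 0 <= C 0 -> 0 <= C 1 ->
  (forall y, 2 <= y -> 0 <= C y) -> forall n : nat, 0 <= C n%:R.
Proof. by move=> C0 C1 C2 [|[|n]] //; apply: C2; rewrite ler_nat. Qed.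

Ltac nonneg :=
  lazymatch goal with
  | |- is_true (0 <= _ + _) => apply: addr_ge0; nonneg
  | |- is_true (0 <= _ * _) => apply: mulr_ge0; nonneg
  | |- is_true (0 <= _ *+ _) => apply: ler0n
  | |- is_true (0 <= 1) => apply: ler01
  | _ => assumption
  end.

(* Reduces a comparison to the given certificate: [cert u d] is the difference
   of the two sides, as a polynomial with nonnegative coefficients. *)
Ltac ratio C f g b0 cert :=
  apply: (@better_of_factored_ratio C f g b0 cert);
  [ by [] | by [] | by [] | by []
  | by move=> y; rewrite /list_poly !big_cons big_nil /component_poly /=; ring
  | by move=> y; rewrite /list_poly !big_cons big_nil /component_poly /=; ring
  | (apply: (@nat_ge0_cases C); cbv beta; [lra | lra |];
    by move=> ? ?; repeat (first [apply: mulr_ge0 | apply: exprn_ge0]); lra)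
  | by cbv beta; lra | by cbv beta; lra
  | by move=> [|[|?]] // _; cbv beta; lra
  | by move=> ? ?; cbv beta zeta; ring
  | by move=> ? ? ? ?; cbv beta; nonneg
  | by cbv beta; lra ].

(** * The individual replacements *)

Notation K1 := (false, 1%N).
Notation K2 := (false, 2%N).
Notation K3 := (true, 3%N).
Notation C4 := (true, 4%N).
Notation C5 := (true, 5%N).

Lemma better_K1_K1 : better [:: K1; K1] [:: K2].
Proof.
ratio (fun y : rat => y + 1) (fun y : rat => y + 1) (fun y : rat => y) 0%N
  (fun u d : rat => 1 + d).
Qed.

Lemma better_K1_K2 : better [:: K1; K2] [:: K3].
Proof.
ratio (fun y : rat => (y + 1) * y) (fun y : rat => y + 1) (fun y : rat => y -
  1) 1%N (fun u d : rat => (1 + d) * (2)).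
Qed.

Lemma better_K2_K2 : better [:: K2; K2] [:: K1; K3].
Proof.
ratio (fun y : rat => (y + 1) ^+ 2 * y) (fun y : rat => y) (fun y : rat => y -
  1) 1%N (fun u d : rat => 1 + d).
Qed.

Lemma better_P3 : better [:: (false, 3%N)] [:: K3].
Proof.
ratio (fun y : rat => (y + 1) * y) (fun y : rat => y) (fun y : rat => y - 1)
  1%N (fun u d : rat => 1 + d).
Qed.

Lemma better_K1_C4 : better [:: K1; C4] [:: C5].
Proof.
ratio (fun y : rat => (y + 1) * y) (fun y : rat => (y + 1) * (y ^+ 2 - y + 1))
  (fun y : rat => (y - 1) * (y ^+ 2 + 1)) 1%N (fun u d : rat => (1 + d) * (10
  + u * (15 + u * (10 + u * (4 + u))) + d * (8 + u * (8 + u * (5 + u * 2)) + d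
  * (2 + u * (1 + u))))).
Qed.

Lemma better_K1_C5 : better [:: K1; C5] [:: K3; K3].
Proof.
ratio (fun y : rat => (y + 1) ^+ 2 * y * (y - 1)) (fun y : rat => y ^+ 2 + 1)
  (fun y : rat => y * (y - 1)) 2%N (fun u d : rat => (1 + d) * (10 + u * (7 +
  u) + d * (3 + u))).
Qed.

Lemma better_K2_C4 : better [:: K2; C4] [:: K3; K3].
Proof.
ratio (fun y : rat => (y + 1) ^+ 2 * y ^+ 2) (fun y : rat => y ^+ 2 - y + 1)
  (fun y : rat => (y - 1) ^+ 2) 1%N (fun u d : rat => (1 + d) * (1 + u * (3 +
  u) + d * (1 + u))).
Qed.

Lemma better_K2_C5 : better [:: K2; C5] [:: C4; K3].
Proof.
ratio (fun y : rat => (y + 1) ^+ 2 * y ^+ 2 * (y - 1)) (fun y : rat => y ^+ 2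
  + 1) (fun y : rat => y ^+ 2 - y + 1) 2%N (fun u d : rat => (1 + d) * (5 + u
  * (5 + u) + d * (2 + u))).
Qed.

Lemma better_C4_C4 : better [:: C4; C4] [:: C5; K3].
Proof.
ratio (fun y : rat => (y + 1) ^+ 2 * y ^+ 2) (fun y : rat => (y ^+ 2 - y + 1)
  ^+ 2) (fun y : rat => (y - 1) ^+ 2 * (y ^+ 2 + 1)) 1%N (fun u d : rat => (1
  + d) * (5 + u * (24 + u * (39 + u * (32 + u * (13 + u * 2)))) + d * (9 + u *
  (32 + u * (41 + u * (24 + u * 5))) + d * (5 + u * (14 + u * (13 + u * 4)) +
  d * (1 + u * (2 + u)))))).
Qed.

Lemma better_C4_C5 : better [:: C4; C5] [:: K3; K3; K3].
Proof.
ratio (fun y : rat => (y + 1) ^+ 2 * y ^+ 2 * (y - 1)) (fun y : rat => (y ^+ 2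
  - y + 1) * (y ^+ 2 + 1)) (fun y : rat => y * (y + 1) * (y - 1) ^+ 2) 2%N
  (fun u d : rat => (1 + d) * (300 + u * (694 + u * (636 + u * (290 + u * (66
  + u * 6)))) + d * (288 + u * (550 + u * (395 + u * (126 + u * 15))) + d *
  (90 + u * (136 + u * (70 + u * 12)) + d * (9 + u * (10 + u * 3)))))).
Qed.

Lemma better_C5_C5 : better [:: C5; C5] [:: C4; K3; K3].
Proof.
ratio (fun y : rat => (y + 1) ^+ 2 * y ^+ 2 * (y - 1) ^+ 2) (fun y : rat => (y
  ^+ 2 + 1) ^+ 2) (fun y : rat => y * (y + 1) * (y ^+ 2 - y + 1)) 2%N (fun u d
  : rat => (1 + d) * (300 + u * (625 + u * (526 + u * (222 + u * (47 + u *
  4)))) + d * (265 + u * (459 + u * (304 + u * (90 + u * 10))) + d * (77 + u *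
  (105 + u * (50 + u * 8)) + d * (7 + u * (7 + u * 2)))))).
Qed.

(** The quotient [(y ^+ 2 + y) / (y ^+ 2 + 1)] takes the value 6/5 at both 2 and 3, so strictness
    starts only with the pair 3, 4. *)
Lemma better_K2_K3 : better [:: K2; K3] [:: C5].
Proof.
ratio (fun y : rat => (y + 1) * y * (y - 1)) (fun y : rat => y ^+ 2 + y) (fun
  y : rat => y ^+ 2 + 1) 2%N (fun u d : rat => (1 + d) * (u * (3 + u) + d * (1
  + u))).
Qed.

Lemma better_C6 : better [:: (true, 6%N)] [:: K3; K3].
Proof.
ratio (fun y : rat => (y + 1) * y) (fun y : rat => y ^+ 4 - y ^+ 3 + y ^+ 2 -
  y + 1) (fun y : rat => y * (y + 1) * (y - 1) ^+ 2) 1%N (fun u d : rat => (1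
  + d) * (6 + u * (29 + u * (53 + u * (48 + u * (22 + u * 4)))) + d * (11 + u
  * (39 + u * (58 + u * (40 + u * 10))) + d * (6 + u * (16 + u * (20 + u * 8))
  + d * (1 + u * (2 + u * 2)))))).
Qed.

(** After cancellation the quotient is [1 - 1 / y ^+ 2], whatever [m]. *)
Lemma better_long_path m : better [:: (false, m.+4)] [:: (false, m.+1); K3].
Proof.
apply: (@better_of_factored_ratio (fun y => (y + 1) * y ^+ m.+1)
  (fun y => y ^+ 2) (fun y => y ^+ 2 - 1) 1
  (fun u d => (1 + d) * (3 + u * 2 + d))).
- by [].
- by [].
- by [].
- by [].
- by move=> y; rewrite /list_poly big_seq1 /component_poly /= !exprS; ring.
- by move=> y; rewrite /list_poly !big_cons big_nil /component_poly /= !exprS; ring.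
- by move=> n; rewrite mulr_ge0 ?exprn_ge0 ?addr_ge0 ?ler0n.
- by rewrite mulr_gt0 ?exprn_gt0 ?addr_gt0 ?ltr0n.
- by rewrite mulr_gt0 ?exprn_gt0 ?addr_gt0 ?ltr0n.
- by move=> [|//] _; rewrite exprS mul0r mulr0.
- by move=> u d; cbv zeta; ring.
- by move=> u d u0 d0; nonneg.
- by lra.
Qed.

(* Divided by [y], the polynomials of the two sides are [f] and [f - e]. The
   quotient [f / e] lies between [y^2 - 1] and [y^2] if [m] is odd and between
   [y^2] and [y^2 + y + 1] if [m] is even, hence increases with the integer [y]. *)
Lemma better_long_cycle m :
  better [:: (true, (m + 7)%N)] [:: (true, (m + 4)%N); K3].
Proof.
pose s : rat := if odd m then 1 else -1.
have sE k : odd k -> (-1) ^+ (m + k) = s.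
  by move=> ok; rewrite -signr_odd oddD ok addbT /s; case: odd.
have sE' k : ~~ odd k -> (-1) ^+ (m + k) = - s.
  move=> ok; rewrite -signr_odd oddD (negPf ok) addbF /s.
  by case: odd; rewrite ?expr1 ?expr0 ?opprK.
pose f (y : rat) := y ^+ (m + 6) + s.
pose e (y : rat) := y ^+ (m + 4) + s * (y ^+ 3 - y + 1).
have pw (y : rat) : 1 <= y -> [/\ 1 <= y ^+ m, 1 <= y ^+ 2, y <= y ^+ 3,
    y ^+ 2 <= y ^+ 3 & y ^+ 3 <= y ^+ 5].
  move=> y1; split; rewrite ?exprn_ege1 ?ler_weXn2l //.
  by rewrite -[leLHS]expr1 ler_weXn2l.
have e_gt0 (y : rat) : 1 < y -> 0 < e y.
  move=> y1; have [M1 y2 y13 y23 y35] := pw y (ltW y1).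
  have h : 0 <= (y ^+ m - 1) * y ^+ 4 by rewrite mulr_ge0 ?exprn_ge0 ?subr_ge0; lra.
  have h' : 0 < (y - 1) * (y ^+ 3 + 1) by apply: mulr_gt0; lra.
  by rewrite /e /s !exprD; case: (odd m); lra.
have e_ge0 (y : rat) : 1 <= y -> 0 <= e y.
  rewrite le_eqVlt => /orP[/eqP<-|/e_gt0/ltW//].
  by rewrite /e /s !expr1n; case: (odd m); lra.
have bounds (y : rat) : 1 <= y ->
    if odd m then (y ^+ 2 - 1) * e y <= f y <= y ^+ 2 * e y
    else y ^+ 2 * e y <= f y <= (y ^+ 2 + y + 1) * e y.
  move=> y1; have [M1 y2 y13 y23 y35] := pw y y1.
  rewrite /f /e /s !exprD; set M := y ^+ m in M1 *.
  case om : (odd m); apply/andP; split.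
  (* Oddness excludes [m = 0]; then [y ^+ (m + 4)] dominates the term [y ^+ 5] of the product on the
     left. *)
  - have My : y <= M by rewrite -[leLHS]expr1 ler_weXn2l //; case: (m) om.
    have : 0 <= y ^+ 4 * (M - y) by rewrite mulr_ge0 ?exprn_ge0 ?subr_ge0; lra.
    by lra.
  - by lra.
  - by lra.
  - have : 0 <= (y ^+ 5 + y ^+ 4) * (M - 1).
      by apply: mulr_ge0; [apply: addr_ge0; apply: exprn_ge0 |]; lra.
    by lra.
(* Divided by [e a * e b], this says that [f / e] grows by at least [b] between [b] and [a]. It
   follows from the bounds because [a ^+ 2 >= (b + 1) ^+ 2]. *)
have mono (a b : rat) : 1 <= b -> b + 1 <= a ->
    f b * e a + b * (e a * e b) <= f a * e b.
  move=> b1 ba; have a1 : 1 <= a by lra.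
  have ab2 : b ^+ 2 + 2 * b + 1 <= a ^+ 2.
    have : 0 <= (a - b - 1) * (a + b + 1) by rewrite mulr_ge0; lra.
    by lra.
  have ee : 0 <= e a * e b by rewrite mulr_ge0 ?e_ge0.
  have := bounds a a1; have := bounds b b1; have := e_ge0 a a1; have := e_ge0 b b1.
  case: (odd m) => eb ea /andP[lb ub] /andP[la ua].
  - have h1 := ler_wpM2r ea ub; have h2 := ler_wpM2r eb la.
    have h3 : 0 <= (a ^+ 2 - 1 - b ^+ 2 - b) * (e a * e b) by rewrite mulr_ge0; lra.
    by lra.
  - have h1 := ler_wpM2r ea ub; have h2 := ler_wpM2r eb la.
    have h3 : 0 <= (a ^+ 2 - (b ^+ 2 + b + 1) - b) * (e a * e b).
      by rewrite mulr_ge0; lra.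
    by lra.
(* The degree varies with [m], so the certificate is the difference itself, equal to
   [f a * e b - f b * e a]; its sign comes from [mono]. *)
apply: (@better_of_factored_ratio id f (fun y => f y - e y) 1 (fun u d =>
  let b := 1 + u in let a := b + 1 + d in f b * (f a - e a) - f a * (f b - e b))).
- by rewrite /valid /= andbT; lia.
- by rewrite /valid /= andbT; lia.
- by [].
- by [].
- move=> y; rewrite /list_poly big_seq1 /component_poly /= sE // /f !exprD.
  by ring.
- move=> y; rewrite /list_poly !big_cons big_nil /component_poly /= sE' //.
  by rewrite /f /e !exprD; ring.
- by move=> n; apply: ler0n.
- by [].
- by [].
- by move=> [].
- by [].
- move=> u d u0 d0 /=; set b := 1 + u; set a := b + 1 + d.
  have h : f b * e a + b * (e a * e b) <= f a * e b by apply: mono; rewrite /a /b; lra.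
  have : 0 <= b * (e a * e b).
    by rewrite !mulr_ge0 ?e_ge0 // /a /b; lra.
  by lra.
have h : f 3 * e 4 + 3 * (e 4 * e 3) <= f 4 * e 3 by apply: mono; lra.
have : 0 < 3 * (e 4 * e 3) by rewrite !mulr_gt0 ?e_gt0 //.
by lra.
Qed.

(** * Triangles with K_1 against triangles with C_4 *)

Lemma list_poly_cons_nseq c k d y :
  list_poly (c :: nseq k d) y = component_poly c y * component_poly d y ^+ k.
Proof. by rewrite /list_poly big_cons big_nseq iter_mulr_1. Qed.

Lemma all_valid_nseq_K3 k : all valid (nseq k K3).
Proof. by rewrite all_nseq orbT. Qed.

(** Both graphs share [j + 2] triangles, and the chromatic polynomials of [K_1] with one triangle
    and of [C_4] share [x * (x - 1)]; the weight is this common factor over [x!]. *)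
Definition weight (j x : nat) : rat :=
  (x%:R * (x%:R - 1) * (x%:R - 2)) ^+ j.+2 * (x%:R * (x%:R - 1)) / (x`!)%:R.

Definition cross_term (w : nat -> rat) (x y : nat) : rat :=
  (x%:R - y%:R) ^+ 2 * ((x%:R - 3) * (y%:R - 3) - 3) * (w x * w y).

(** Without the common factor the polynomials are [x * (x - 2)] and [x ^+ 2 - 3 * x + 3], that is
    [z ^+ 2 + 4 * z + 3] and [z ^+ 2 + 3 * z + 3] with [z = x - 3]. *)
Lemma cross_row_term j x :
  cross_row (color_fun (graph_of (K1 :: nseq j.+3 K3)))
            (color_fun (graph_of (C4 :: nseq j.+2 K3))) x
  = \sum_(y < x) - cross_term (weight j) x y.
Proof.
apply: eq_bigr => y _.
rewrite !color_fun_graph_of ?list_poly_cons_nseq /= ?all_valid_nseq_K3 //.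
rewrite /component_poly /= /cross_term /weight.
have e (z : rat) : (z - 1) ^+ 3 + (-1) ^+ 3 * (z - 1) = z * (z - 1) * (z - 2).
  by ring.
rewrite !e ![_ ^+ j.+3]exprS.
by field; rewrite !natfact_neq0.
Qed.

Lemma weight_small j x : (x < 3)%N -> weight j x = 0.
Proof.
case: x => [|[|[|//]]] _; rewrite /weight.
- by rewrite !mul0r exprS !mul0r.
- by rewrite subrr mulr0 !mul0r.
- by rewrite subrr mulr0 exprS !mul0r.
Qed.

Lemma weight_ge0 j x : 0 <= weight j x.
Proof.
case: (ltnP x 3) => x3; first by rewrite weight_small.
have x3' : 3 <= x%:R :> rat by rewrite ler_nat.
have h : 0 <= x%:R * (x%:R - 1) :> rat by apply: mulr_ge0; lra.
apply: mulr_ge0; last by rewrite invr_ge0 ler0n.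
by rewrite mulr_ge0 // exprn_ge0 // mulr_ge0 //; lra.
Qed.

Lemma weight3 j : weight j 3 = 36 * 6 ^+ j.
Proof.
rewrite /weight (_ : 3%:R * (3%:R - 1) * (3%:R - 2) = 6); last by ring.
by rewrite !factS fact0 !natrM !exprS; field.
Qed.

Lemma weight4 j : weight j 4 = 288 * 24 ^+ j.
Proof.
rewrite /weight (_ : 4%:R * (4%:R - 1) * (4%:R - 2) = 24); last by ring.
by rewrite !factS fact0 !natrM !exprS; field.
Qed.

Lemma weight5 j : weight j 5 = 600 * 60 ^+ j.
Proof.
rewrite /weight (_ : 5%:R * (5%:R - 1) * (5%:R - 2) = 60); last by ring.
by rewrite !factS fact0 !natrM !exprS; field.
Qed.

Lemma weight6 j : weight j 6 = 600 * 120 ^+ j.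
Proof.
rewrite /weight (_ : 6%:R * (6%:R - 1) * (6%:R - 2) = 120); last by ring.
by rewrite !factS fact0 !natrM !exprS; field.
Qed.

(** For [x >= 7] only [y = 3] contributes with the wrong sign. It is outweighed by [y = 5], since
    [60 ^+ j >= 6 ^+ j]; in [X = x - 7] the remaining polynomial has nonnegative coefficients. *)
Lemma row_le0 j x : (7 <= x)%N -> \sum_(y < x) - cross_term (weight j) x y <= 0.
Proof.
move=> x7; have h3 : (3 < x)%N by lia. have h5 : (5 < x)%N by lia.
have split_sum (F : nat -> rat) : \sum_(y < x) F y = F 3 + F 5 +
    \sum_(y < x | (y != Ordinal h3) && (y != Ordinal h5)) F y.
  by rewrite (bigD1 (Ordinal h3)) // (bigD1 (Ordinal h5)) //= addrA.
rewrite (split_sum (fun y => - cross_term (weight j) x y)).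
have x7' : 7 <= x%:R :> rat by rewrite ler_nat.
rewrite -[leRHS]addr0; apply: lerD; last first.
  apply: sumr_le0 => y /andP[y3 y5]; rewrite oppr_le0 /cross_term.
  case: (ltnP y 3) => y3'; first by rewrite (weight_small j y3') !mulr0.
  have y4 : (4 <= y)%N by move: y3; rewrite -val_eqE /=; lia.
  have y4' : 4 <= y%:R :> rat by rewrite ler_nat.
  have p : 0 <= (x%:R - 7) * (y%:R - 4) :> rat by apply: mulr_ge0; lra.
  apply: mulr_ge0; last by apply: mulr_ge0; apply: weight_ge0.
  by apply: mulr_ge0; [apply: sqr_ge0 | lra].
rewrite /cross_term weight3 weight5.
have w : 6 ^+ j <= 60 ^+ j :> rat by apply: lerXn2r; rewrite ?nnegrE ?ler0n ?ler_nat.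
have w6 : 0 < 6 ^+ j :> rat by rewrite exprn_gt0.
have wx := weight_ge0 j x; set X : rat := x%:R - 7.
have X0 : 0 <= X by rewrite /X; lra.
have -> : x%:R = X + 7 :> rat by rewrite /X; ring.
have h : 0 <= (X + 2) ^+ 2 * (2 * X + 5) * 600 * 60 ^+ j
             - 108 * (X + 4) ^+ 2 * 6 ^+ j :> rat.
  have p1 : 0 <= (X + 2) ^+ 2 * (2 * X + 5) by rewrite mulr_ge0 ?sqr_ge0; lra.
  have p2 := ler_wpM2l p1 w.
  have p3 : 0 <= ((X + 2) ^+ 2 * (2 * X + 5) * 600 - 108 * (X + 4) ^+ 2) * 6 ^+ j.
    apply: mulr_ge0; last exact: ltW.
    have -> : (X + 2) ^+ 2 * (2 * X + 5) * 600 - 108 * (X + 4) ^+ 2 =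
      10272 + X * (15936 + X * (7692 + X * 1200)) by ring.
    by nonneg.
  by lra.
have := mulr_ge0 h wx.
by lra.
Qed.

(** The total of [cross_term] over the pairs among 3, 4, 5, 6. The pair of 4 and 6 is absent: there
    [(x - 3) * (y - 3) = 3]. *)
Definition weight_gap (w : nat -> rat) : rat := 3 * w 5 * w 6
  - 27 * w 3 * w 6 - 3 * w 3 * w 4 - 12 * w 3 * w 5 - w 4 * w 5.

Lemma weight_gap_gt0 j : 0 < weight_gap (weight j).
Proof.
rewrite /weight_gap weight3 weight4 weight5 weight6.
have pq : 6 ^+ j <= 24 ^+ j :> rat by apply: lerXn2r; rewrite ?nnegrE ?ler0n ?ler_nat.
have qr : 24 ^+ j <= 60 ^+ j :> rat by apply: lerXn2r; rewrite ?nnegrE ?ler0n ?ler_nat.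
have rt : 60 ^+ j <= 120 ^+ j :> rat by apply: lerXn2r; rewrite ?nnegrE ?ler0n ?ler_nat.
have p0 : 0 < 6 ^+ j :> rat by rewrite exprn_gt0.
(* From here on only [0 < p <= q <= r <= t] matters. *)
move: (6 ^+ j) (24 ^+ j) (60 ^+ j) (120 ^+ j) pq qr rt p0 => p q r t pq qr rt p0.
have h1 : 0 <= (t - r) * (r - p) by apply: mulr_ge0; lra.
have h2 : 0 <= (t - r) * r by apply: mulr_ge0; lra.
have h3 : 0 <= r * (r - p) by apply: mulr_ge0; lra.
have h4 : 0 <= r * (r - q) by apply: mulr_ge0; lra.
have h5 : 0 <= q * (r - p) by apply: mulr_ge0; lra.
have h6 : 0 < r * r by apply: mulr_gt0; lra.
by lra.
Qed.

Lemma first_rows (w : nat -> rat) : w 0%N = 0 -> w 1%N = 0 -> w 2%N = 0 ->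
  \sum_(x < 7) \sum_(y < x) - cross_term w x y = - weight_gap w.
Proof.
move=> w0 w1 w2.
have unfold_sum (F : nat -> nat -> rat) : \sum_(x < 7) \sum_(y < x) F x y =
    F 1 0 + (F 2 0 + F 2 1) + (F 3 0 + F 3 1 + F 3 2)
    + (F 4 0 + F 4 1 + F 4 2 + F 4 3)
    + (F 5 0 + F 5 1 + F 5 2 + F 5 3 + F 5 4)
    + (F 6 0 + F 6 1 + F 6 2 + F 6 3 + F 6 4 + F 6 5).
  by rewrite !big_ord_recr !big_ord0 /= !add0r.
by rewrite (unfold_sum (fun x y => - cross_term w x y)) /cross_term w0 w1 w2 /weight_gap; ring.
Qed.

Lemma sum_le_head (N0 N : nat) (r : nat -> rat) (d : rat) : (N0 <= N)%N ->
  \sum_(x < N0) r x = d -> (forall x, (N0 <= x)%N -> r x <= 0) ->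
  \sum_(x < N) r x <= d.
Proof.
move=> N0N <- r0; rewrite -!(big_mkord xpredT r) (big_cat_nat (n := N0)) //=.
by rewrite gerDl big_nat; apply: sumr_le0 => x /andP[x0 _]; apply: r0.
Qed.

(* With [z = x - 3], the symmetrised summand is, up to sign, proportional to
   [(z - z')^2 (z z' - 3)]; its few negative values, at [z = 0] and at
   [{z, z'} = {1, 2}], are outweighed by those at [z = 2]. *)
Lemma A_K1_lt_C4 j :
  A_ (graph_of (K1 :: nseq j.+3 K3)) < A_ (graph_of (C4 :: nseq j.+2 K3)).
Proof.
refine (A_lt_cross (N0 := 7) _ _ (weight_gap_gt0 j) _).
- by rewrite card_graph_of order_of_gt0 //= all_valid_nseq_K3.
- by rewrite card_graph_of order_of_gt0 //= all_valid_nseq_K3.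
move=> N N7; rewrite cross_sum_rows.
under eq_bigr do rewrite cross_row_term.
refine (sum_le_head N7 (first_rows _ _ _) (@row_le0 j)); exact: weight_small.
Qed.

(** * Explicit values for the orders 4 and 7 *)

Lemma A_seq_coef s (c : seq rat) (b t : rat) : all valid s -> s != [::] ->
  (forall x : nat, list_poly s (x%:R - 1) = ffact_poly (size c) (nth 0 c) x) ->
  coef_mass (size c) (nth 0 c) = b -> coef_moment (size c) (nth 0 c) = t ->
  b != 0 -> A_ (graph_of s) = t / b.
Proof.
move=> vs s0 e <- <-; apply: A_coef; first by rewrite card_graph_of order_of_gt0.
by move=> x; rewrite color_fun_graph_of.
Qed.

Ltac expand_coefs :=
  [> by []
  | by []
  | by move=> x; rewrite /list_poly !big_cons big_nil /component_poly;
    rewrite /ffact_poly !big_ord_recr big_ord0 /= !natr_ffactSr ffactn0; ring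
  | by rewrite /coef_mass !big_ord_recr big_ord0 /=; ring
  | by rewrite /coef_moment !big_ord_recr big_ord0 /=; ring
  | by [] ].

Lemma A_C4_lt_K1K3 : A_ (graph_of [:: C4]) < A_ (graph_of [:: K1; K3]).
Proof.
have -> : A_ (graph_of [:: C4]) = 12 / 4.
  (* The entries count stable partitions by number of blocks: [C_4] has one with 2 blocks, two with
     3 and one with 4. *)
  apply: (@A_seq_coef _ [:: 0; 0; 1; 2; 1]); expand_coefs.
have -> : A_ (graph_of [:: K1; K3]) = 13 / 4.
  apply: (@A_seq_coef _ [:: 0; 0; 0; 3; 1]); expand_coefs.
by lra.
Qed.

Lemma A_C4K3_lt_K1K3K3 :
  A_ (graph_of [:: C4; K3]) < A_ (graph_of [:: K1; K3; K3]).
Proof.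
have -> : A_ (graph_of [:: C4; K3]) = 684 / 154.
  apply: (@A_seq_coef _ [:: 0; 0; 0; 18; 66; 55; 14; 1]); expand_coefs.
have -> : A_ (graph_of [:: K1; K3; K3]) = 778 / 175.
  apply: (@A_seq_coef _ [:: 0; 0; 0; 18; 78; 63; 15; 1]); expand_coefs.
by lra.
Qed.

(** * Reduction to the extremal graph *)

Lemma A_iso (G H : sgraph) : isomorphic G H -> A_ G = A_ H.
Proof.
move=> iso; have cardGH : #|G| = #|H| by case: iso => f /bij_eq_card.
have [G0|G0] := posnP #|G|.
  by rewrite /A_ /T_ /B_ -cardGH G0 !big_geq.
by apply: eq_A; rewrite -?cardGH //; apply: color_fun_iso.
Qed.

Lemma A_perm s t : perm_eq s t -> A_ (graph_of s) = A_ (graph_of t).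
Proof. by move=> /iso_perm /A_iso. Qed.

(** Permutation is kept apart from strict improvement for the sake of the equality case: a list with
    no strict improvement on the way is a rearrangement of the final one. *)
Definition improves (s t : seq (bool * nat)) : Prop :=
  [/\ all valid t, order_of s = order_of t & perm_eq s t \/ better s t].

Lemma order_of_cat s t : order_of (s ++ t) = (order_of s + order_of t)%N.
Proof. by rewrite /order_of map_cat sumn_cat. Qed.

Lemma order_of_perm s t : perm_eq s t -> order_of s = order_of t.
Proof. by move=> st; apply/perm_sumn/perm_map. Qed.

Lemma improves_perm s t : all valid s -> perm_eq s t -> improves s t.
Proof.
by move=> vs st; split; [rewrite -(perm_all _ st) | apply: order_of_perm | left].
Qed.

Lemma improves_better s t : all valid t -> order_of s = order_of t ->
  better s t -> improves s t.
Proof. by move=> vt e b; split; [| | right]. Qed.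

Lemma improves_trans s t u : improves s t -> improves t u -> improves s u.
Proof.
move=> [_ est st] [vu etu tu]; split=> //; first by rewrite est.
case: st tu => [st|st] [tu|tu].
- by left; apply: perm_trans tu.
- right=> v vv; rewrite (@A_perm _ (t ++ v)); first exact: tu.
  by rewrite perm_cat2r.
- right=> v vv; rewrite (@A_perm (u ++ v) (t ++ v)); first exact: st.
  by rewrite perm_cat2r perm_sym.
- by right=> v vv; apply: lt_trans (st v vv) (tu v vv).
Qed.

Lemma improves_cat s t u : all valid u -> improves s t -> improves (s ++ u) (t ++ u).
Proof.
move=> vu [vt est st]; split; first by rewrite all_cat vt.
  by rewrite !order_of_cat est.
case: st => [st|st]; first by left; rewrite perm_cat2r.
by right=> v vv; rewrite -!catA; apply: st; rewrite all_cat vu.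
Qed.

Definition remainders : seq (seq (bool * nat)) :=
  [:: [::]; [:: K1]; [:: K2]; [:: C4]; [:: C5]].

Lemma remainder_valid r : r \in remainders -> all valid r.
Proof. by rewrite !inE => /or4P[|||/orP[]] /eqP->. Qed.

Definition reducible s := exists r a,
  r \in remainders /\ improves s (r ++ nseq a K3).

Lemma reducible_improves s t : improves s t -> reducible t -> reducible s.
Proof.
move=> st [r [a [rr tr]]]; exists r, a; split=> //.
exact: improves_trans st tr.
Qed.

Lemma reducible_cat_triangles s k : reducible s -> reducible (s ++ nseq k K3).
Proof.
move=> [r [a [rr sr]]]; exists r, (a + k)%N; split=> //.
by rewrite nseqD catA; apply: improves_cat => //; apply: all_valid_nseq_K3.
Qed.

Lemma reducible_remainder r a : r \in remainders -> reducible (r ++ nseq a K3).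
Proof.
move=> rr; exists r, a; split=> //; apply: improves_perm => //.
by rewrite all_cat remainder_valid ?all_valid_nseq_K3.
Qed.

Lemma reducible_better s r a : r \in remainders ->
  order_of s = order_of (r ++ nseq a K3) -> better s (r ++ nseq a K3) ->
  reducible s.
Proof.
move=> rr e b; exists r, a; split=> //; apply: improves_better => //.
by rewrite all_cat remainder_valid ?all_valid_nseq_K3.
Qed.

(** Strong induction on the size: a cycle on at least 7 or a path on at least 4 vertices sheds a
    triangle. [C_6] and the path on 3 vertices have replacements of their own. *)
Lemma reducible_component c : valid c -> reducible [:: c].
Proof.
case: c => b m; elim/ltn_ind: m => m IH.
case: b IH => IH; rewrite /valid /=.
- case: m IH => [|[|[|[|[|[|[|m]]]]]]] IH //= _.
  + exact: (@reducible_remainder [::] 1).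
  + exact: (@reducible_remainder [:: C4] 0).
  + exact: (@reducible_remainder [:: C5] 0).
  + exact: (@reducible_better _ [::] 2) better_C6.
  apply: (@reducible_improves _ ([:: (true, m.+4)] ++ nseq 1 K3)).
    apply: improves_better; first by rewrite /= /valid /=.
      by rewrite /order_of /=; lia.
    by have := better_long_cycle m; rewrite !addnS addn0.
  by apply/reducible_cat_triangles/IH; rewrite /valid /=; lia.
- case: m IH => [|[|[|[|m]]]] IH //= _.
  + exact: (@reducible_remainder [:: K1] 0).
  + exact: (@reducible_remainder [:: K2] 0).
  + exact: (@reducible_better _ [::] 1) better_P3.
  apply: (@reducible_improves _ ([:: (false, m.+1)] ++ nseq 1 K3)).
    apply: improves_better; first by rewrite /= /valid /=.
      by rewrite /order_of /=; lia.
    exact: better_long_path.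
  by apply/reducible_cat_triangles/IH; rewrite /valid /=; lia.
Qed.

Lemma reducible_swap s t : all valid (s ++ t) -> reducible (t ++ s) ->
  reducible (s ++ t).
Proof.
move=> v; apply: reducible_improves; apply: improves_perm => //.
by rewrite perm_catC.
Qed.

(** Two nonempty remainders merge into triangles with at most one remainder. The ten unordered pairs
    are listed; the other orders follow by swapping. *)
Lemma reducible_pair r r' : r \in remainders -> r' \in remainders ->
  reducible (r ++ r').
Proof.
have [K1' K2' C4' C5'] : [/\ [:: K1] \in remainders, [:: K2] \in remainders,
  [:: C4] \in remainders & [:: C5] \in remainders] by [].
have nil : forall r, r \in remainders -> reducible r.
  by move=> q qr; have := reducible_remainder 0 qr; rewrite cats0.
have k1k2 : reducible [:: K1; K2] by apply: (@reducible_better _ [::] 1) better_K1_K2.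
have k1c4 : reducible [:: K1; C4] by apply: (@reducible_better _ [:: C5] 0) better_K1_C4.
have k1c5 : reducible [:: K1; C5] by apply: (@reducible_better _ [::] 2) better_K1_C5.
have k2c4 : reducible [:: K2; C4] by apply: (@reducible_better _ [::] 2) better_K2_C4.
have k2c5 : reducible [:: K2; C5] by apply: (@reducible_better _ [:: C4] 1) better_K2_C5.
have c4c5 : reducible [:: C4; C5] by apply: (@reducible_better _ [::] 3) better_C4_C5.
have k1k1 : reducible [:: K1; K1] by apply: (@reducible_better _ [:: K2] 0) better_K1_K1.
have k2k2 : reducible [:: K2; K2] by apply: (@reducible_better _ [:: K1] 1) better_K2_K2.
have c4c4 : reducible [:: C4; C4] by apply: (@reducible_better _ [:: C5] 1) better_C4_C4.
have c5c5 : reducible [:: C5; C5] by apply: (@reducible_better _ [:: C4] 2) better_C5_C5.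
move=> rr; have := rr; rewrite inE => /orP[/eqP->|]; first exact: nil.
move=> + rr'; have := rr'; rewrite inE => /orP[/eqP-> _|].
  by rewrite cats0; apply: nil.
rewrite !inE => /or4P[]/eqP-> /or4P[]/eqP-> //=;
  exact: (@reducible_swap [:: _] [:: _]).
Qed.

(** The head and the tail are reduced separately, then their two remainders are merged. *)
Lemma reducible_all s : all valid s -> reducible s.
Proof.
elim: s => [_|c s IH /andP[vc vs]]; first exact: (@reducible_remainder [::] 0).
have [r [a [rr cr]]] := reducible_component vc.
have [r' [a' [rr' sr']]] := IH vs.
have vr := remainder_valid rr; have vr' := remainder_valid rr'.
have vK k : all valid (nseq k K3) := all_valid_nseq_K3 k.
apply: (@reducible_improves _ ((r ++ nseq a K3) ++ s)).
  exact: (@improves_cat [:: c]).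
apply: (@reducible_improves _ (s ++ (r ++ nseq a K3))).
  by apply: improves_perm; rewrite ?all_cat ?vr ?vK ?vs // perm_catC.
apply: (@reducible_improves _ ((r' ++ nseq a' K3) ++ (r ++ nseq a K3))).
  by apply: improves_cat => //; rewrite all_cat vr vK.
apply: (@reducible_improves _ ((r ++ r') ++ nseq (a + a') K3)).
  apply: improves_perm; first by rewrite !all_cat vr vr' !vK.
  by rewrite nseqD; apply/permP => p; rewrite !count_cat; lia.
by apply/reducible_cat_triangles/reducible_pair.
Qed.

(** * Comparison with [U_ n] *)

Definition U_list (n : nat) : seq (bool * nat) :=
  (if n %% 3 == 0 then nseq (n %/ 3) K3
  else if (n == 4) || (n == 7) then K1 :: nseq ((n - 1) %/ 3) K3
  else if n %% 3 == 1 then C4 :: nseq ((n - 4) %/ 3) K3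
  else C5 :: nseq ((n - 5) %/ 3) K3)%N.

Lemma iso_U_list n : isomorphic (U_ n) (graph_of (U_list n)).
Proof.
rewrite /U_ /U_list.
have copies_union (H : sgraph) p c : isomorphic H (component c) ->
    isomorphic (disjoint_union (copies p (K_ 3)) H) (graph_of (c :: nseq p K3)).
  move=> Hc; apply: iso_trans (iso_union_comm _ _) _.
  exact: iso_union Hc (iso_copies_triangle p).
case: ifP => _; first exact: iso_copies_triangle.
case: ifP => _.
  apply: copies_union; exists (id : K_ 1 -> path_graph 1); first by exists id.
  by move=> x y; rewrite !ord1.
by case: ifP => _; apply: copies_union; apply: iso_refl.
Qed.

Ltac U_cases := rewrite /U_list; repeat (case: ifP => ?; try by exfalso; lia).

(** The order modulo 3 leaves at most two candidates: no remainder for 0, [K_1] or [C_4] for 1,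
    [K_2] or [C_5] for 2. *)
Lemma A_lt_U_list s : all valid s -> (3 <= order_of s)%N ->
  perm_eq s (U_list (order_of s)) \/
  A_ (graph_of s) < A_ (graph_of (U_list (order_of s))).
Proof.
move=> vs s3; have [r [a [rr [_ so st]]]] := reducible_all vs.
have nseq_order k : order_of (nseq k K3) = (k * 3)%N.
  by elim: k => // k; rewrite /order_of /= => ->; lia.
have st' : perm_eq s (r ++ nseq a K3) \/
    A_ (graph_of s) < A_ (graph_of (r ++ nseq a K3)).
  case: st => [|b]; first by left.
  by right; have := b [::] isT; rewrite !cats0.
suff [<-|lt] : r ++ nseq a K3 = U_list (order_of s) \/
    A_ (graph_of (r ++ nseq a K3)) < A_ (graph_of (U_list (order_of s))).
- exact: st'.
- right; case: st' => [/A_perm->//|h]; apply: lt_trans h lt.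
move: so s3 => {st st' vs}; rewrite order_of_cat nseq_order; move: (order_of s) => n.
move: rr; rewrite !inE => /or4P[|||/orP[]] /eqP-> /=; rewrite /order_of /= => -> n3.
- by left; U_cases; congr nseq; lia.
(* With [K_1], no triangle means order 1, one or two mean the orders 4 and 7 where this list is
   extremal, and from three on [C_4] wins. *)
- case: a n3 => [|[|[|a]]] n3 //; [by left | by left |]; right; U_cases.
  have -> : ((1 + 0 + a.+3 * 3 - 4) %/ 3 = a.+2)%N by lia.
  exact: A_K1_lt_C4.
- case: a n3 => [//|a] _; right; U_cases.
  have -> : ((2 + 0 + a.+1 * 3 - 5) %/ 3 = a)%N by lia.
  exact: better_K2_K3 (all_valid_nseq_K3 a).
(* With [C_4], zero or one triangle gives the orders 4 and 7, where [K_1] wins. *)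
- case: a n3 => [|[|a]] _; first by right; apply: A_C4_lt_K1K3.
    by right; apply: A_C4K3_lt_K1K3K3.
  by left; U_cases; congr (_ :: nseq _ _); lia.
- by left; U_cases; congr (_ :: nseq _ _); lia.
Qed.

Local Close Scope ring_scope.

Theorem theorem18 (n : nat) (G : sgraph) (order_G : #|G| = n) (n_ge3 : 3 <= n)
    (maxdeg_G : max_degree G = 2) :
  (A_ G <= A_ (U_ n))%R /\ (A_ G = A_ (U_ n) <-> isomorphic G (U_ n)).
Proof.
have d2 (x : G) : degree x <= 2.
  by rewrite -maxdeg_G; apply: (leq_bigmax (F := @degree G)).
have [s [vs Gs]] := decomposition d2.
have ns : n = order_of s.
  by rewrite -order_G -card_graph_of; case: Gs => f /bij_eq_card.
have AG : A_ G = A_ (graph_of s) := A_iso Gs.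
have AU : A_ (U_ n) = A_ (graph_of (U_list n)) := A_iso (iso_U_list n).
(* The first alternative gives an isomorphism, the second a strict inequality; this settles the
   equality case. *)
have := A_lt_U_list vs; rewrite -ns => /(_ n_ge3) [perm | lt].
  have GU : isomorphic G (U_ n).
    apply: iso_trans Gs (iso_trans (iso_perm perm) _).
    exact: iso_sym (iso_U_list n).
  by rewrite (A_iso GU); split.
rewrite AU AG; split; first exact: Order.POrderTheory.ltW.
split=> [e|/A_iso]; first by rewrite e Order.POrderTheory.ltxx in lt.
by rewrite AG AU.
Qed.
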